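(* Let $p\ge 3$ be an integer. For any integers $m\le 2^{p}-1$ and $n\ge 2$ with $p=m-n$, there exists a polytopal $(n-1)$-dimensional seed $K$ with $m$ vertices such that $s(K)=p$.
   Context: All simplicial complexes are finite abstract simplicial complexes and are pure; the dimension of a face $\sigma$ is $|\sigma|-1$. PL spheres: a simplicial complex $K$ is a PL sphere if some subdivision of $K$ is (isomorphic to) a subdivision of the boundary complex of a simplex. It is polytopal if it is isomorphic to the boundary complex of a simplicial convex polytope. Wedge: for a vertex $v$ of $K$ and a new vertex $v'$, let $I$ be the $1$-simplex with vertices $v,v'$ and $\partial I$ its boundary (two points). With $\mathrm{Lk}_K(v)=\{\tau\in K: v\notin\tau,\ \tau\cup\{v\}\in K\}$ and join $A*B=\{\sigma\cup\tau:\sigma\in A,\tau\in B\}$, the wedge is $\mathrm{Wed}_v(K)=(I*\mathrm{Lk}_K(v))\cup(\partial I*\{\sigma\in K: v\notin\sigma\})$. Seed: a PL sphere that is not (isomorphic to) a wedge $\mathrm{Wed}_v(L)$ of any PL sphere $L$ at a vertex $v$ of $L$. Buchstaber number: for a simplicial complex $K$ with vertex set $[m]=\{1,\dots,m\}$, the moment-angle complex is $$\mathcal{Z}_K=\bigcup_{\sigma\in K}\{(x_1,\dots,x_m)\in (D^2)^m : x_i\in S^1 \text{ whenever } i\notin\sigma\},$$ where $D^2=\{z\in\mathbb{C}:|z|\le 1\}$ and $S^1=\partial D^2$. The torus $T^m=(S^1)^m$ acts on $\mathcal{Z}_K$ by coordinatewise multiplication. The Buchstaber number $s(K)$ is the maximum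 $r$ such that some $r$-dimensional subtorus of $T^m$ acts freely on $\mathcal{Z}_K$. *)

(* Defs.v *)
From HB Require Import structures.
From mathcomp Require Import all_boot all_order all_algebra.
From mathcomp Require Import complex.
From mathcomp Require Import all_classical all_reals all_analysis.

Set Implicit Arguments.
Unset Strict Implicit.
Unset Printing Implicit Defensive.

Import Order.TTheory GRing.Theory Num.Theory.
Import numFieldNormedType.Exports.

Local Open Scope classical_set_scope.
Local Open Scope ring_scope.

(** * Finite abstract simplicial complexes

   A complex is its family of faces [K : {set {set V}}], the empty face
   included. There are no ghost vertices: the vertex set is the whole of [V]. *)

Definition facet (V : finType) (K : {set {set V}}) (s : {set V}) : Prop :=
  s \in K /\ (forall t : {set V}, t \in K -> s \subset t -> t = s).

Definition pure (V : finType) (K : {set {set V}}) : Prop :=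
  forall s t : {set V}, facet K s -> facet K t -> #|s| = #|t|.

Definition simplicial_complex (V : finType) (K : {set {set V}}) : Prop :=
  [/\ finset.set0 \in K,
      (forall s t : {set V}, t \subset s -> s \in K -> t \in K),
      (forall v : V, [set v]%SET \in K) &
      pure K].

Definition complex_dim (V : finType) (K : {set {set V}}) : int :=
  (\max_(s in K) #|s|)%N%:Z - 1.

Definition complex_iso (V W : finType) (K : {set {set V}}) (L : {set {set W}}) :
    Prop :=
  exists2 f : V -> W, bijective f &
    forall s : {set V}, ((f @: s)%SET \in L) = (s \in K).

Definition simplex_bd (V : finType) (A : {set V}) : {set {set V}} :=
  [set s : {set V} | s \proper A]%SET.

Definition join (V : finType) (A B : {set {set V}}) : {set {set V}} :=
  [set a :|: b | a : {set V} in A, b : {set V} in B]%SET.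

Definition link (V : finType) (K : {set {set V}}) (v : V) : {set {set V}} :=
  [set t in K | (v \notin t) && (v |: t \in K)]%SET.

Definition deletion (V : finType) (K : {set {set V}}) (v : V) :
    {set {set V}} :=
  [set s in K | v \notin s]%SET.

(* The vertices of the wedge are [Some u] for the vertices [u] of [K],
   and the new vertex v' is [None]. *)
Definition old_faces (V : finType) (K : {set {set V}}) :
    {set {set (option V)}} :=
  [set (Some @: s)%SET | s : {set V} in K]%SET.

Definition wedge (V : finType) (K : {set {set V}}) (v : V) :
    {set {set (option V)}} :=
  let I := [set Some v; None]%SET in
  (join (powerset I) (old_faces (link K v))
   :|: join (simplex_bd I) (old_faces (deletion K v)))%SET.

(** * Geometric realization, subdivisions and PL spheres *)

Definition convex_weights (R : realType) (I : finType) : set {ffun I -> R} :=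
  [set a | (forall i, 0 <= a i) /\ \sum_i a i = 1].
Arguments convex_weights R I : clear implicits.

Definition realization (R : realType) (V : finType) (K : {set {set V}}) :
    set {ffun V -> R} :=
  [set a | convex_weights R V a /\ [set v | a v != 0]%SET \in K].
Arguments realization R {V} K.

Definition linear_extension (R : realType) (W V : finType)
    (f : W -> {ffun V -> R}) (a : {ffun W -> R}) :
    {ffun V -> R} :=
  [ffun v => \sum_w a w * f w v].

(* [K'] is a subdivision of [K]: its vertices are placed (by [f]) in the
   realization of [K], so that each simplex of [K'] lies in a simplex of [K] and
   the simplices of [K'] form a geometric simplicial complex with union |K|. The
   last condition says that the map |K'| -> |K| that is affine on the simplices
   and extends [f] is a bijection. *)
Definition subdivision (R : realType) (W V : finType) (K' : {set {set W}})
    (K : {set {set V}}) : Prop :=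
  simplicial_complex K' /\
  exists f : W -> {ffun V -> R},
    (forall s : {set W}, s \in K' -> exists2 t : {set V}, t \in K &
       forall w v, w \in s -> f w v != 0 -> v \in t) /\
    set_bij (realization R K') (realization R K) (linear_extension f).

Definition pl_sphere (R : realType) (V : finType) (K : {set {set V}}) : Prop :=
  simplicial_complex K /\
  exists (W W' : finType) (K' : {set {set W}}) (L' : {set {set W'}}) (k : nat),
    [/\ subdivision R K' K,
        subdivision R L' (simplex_bd [set: 'I_k.+1]%SET) &
        complex_iso K' L'].

Definition seed (R : realType) (V : finType) (K : {set {set V}}) : Prop :=
  pl_sphere R K /\
  ~ (exists (W : finType) (L : {set {set W}}) (v : W),
       pl_sphere R L /\ complex_iso K (wedge L v)).

(** * Simplicial polytopes *)

Definition conv_hull (R : realType) (d : nat) (I : finType)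
    (x : I -> 'rV[R]_d) : set 'rV[R]_d :=
  [set \sum_i a i *: x i | a in convex_weights R I].

Definition affinely_independent (R : realType) (d : nat) (I : finType)
    (x : I -> 'rV[R]_d) : Prop :=
  forall a : I -> R, \sum_i a i = 0 -> \sum_i a i *: x i = 0 ->
    forall i, a i = 0.

(* [k = 0] gives the empty simplex. *)
Definition geometric_simplex (R : realType) (d : nat) (F : set 'rV[R]_d) :
    Prop :=
  exists (k : nat) (x : 'I_k -> 'rV[R]_d),
    affinely_independent x /\ F = conv_hull x.

Definition polytope (R : realType) (d : nat) (P : set 'rV[R]_d) : Prop :=
  exists (k : nat) (x : 'I_k -> 'rV[R]_d), P = conv_hull x.

(* With [c = 0], both the empty set and [P] itself are faces of [P]. *)
Definition polytope_face (R : realType) (d : nat) (P F : set 'rV[R]_d) : Prop :=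
  exists (c : 'rV[R]_d) (b : R),
    (forall y, P y -> \sum_j c 0 j * y 0 j <= b) /\
    F = P `&` [set y | \sum_j c 0 j * y 0 j = b].

Definition proper_face (R : realType) (d : nat) (P F : set 'rV[R]_d) : Prop :=
  polytope_face P F /\ F <> P.

Definition simplicial_polytope (R : realType) (d : nat) (P : set 'rV[R]_d) :
    Prop :=
  polytope P /\ forall F, proper_face P F -> geometric_simplex F.

Definition polytope_vertices (R : realType) (d : nat) (P : set 'rV[R]_d) :
    set 'rV[R]_d :=
  [set y | polytope_face P [set y]].

(* [x] is an isomorphism from [K] to the boundary complex of [P], whose faces
   are the vertex sets of the proper faces of [P]. *)
Definition polytopal (R : realType) (V : finType) (K : {set {set V}}) : Prop :=
  simplicial_complex K /\
  exists (d : nat) (P : set 'rV[R]_d) (x : V -> 'rV[R]_d),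
    [/\ simplicial_polytope P,
        set_bij [set: V] (polytope_vertices P) x &
        forall s : {set V}, s \in K <->
          exists2 F, proper_face P F & forall v, v \in s <-> F (x v)].

(** * Moment-angle complexes and the Buchstaber number *)

(* Without this alias the topology of the numeric field R[i] is not inferred. *)
Definition cplx (R : realType) : numClosedFieldType := R[i]%C.

Definition torus (R : realType) (m : nat) : set 'rV[cplx R]_m :=
  [set t | forall i, `|t 0 i| = 1].
Arguments torus R m : clear implicits.

Definition coord_mul (R : realType) (m : nat) (t x : 'rV[cplx R]_m) :
    'rV[cplx R]_m :=
  \row_i (t 0 i * x 0 i).

Definition moment_angle (R : realType) (m : nat) (K : {set {set 'I_m}}) :
    set 'rV[cplx R]_m :=
  \bigcup_(s in [set` K])
    [set x | forall i, `|x 0 i| <= 1 /\ (i \notin s -> `|x 0 i| = 1)].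
Arguments moment_angle R {m} K.

(* [H] is the image of an injective continuous homomorphism T^r -> T^m; as T^r
   is compact, this is a closed subgroup isomorphic to T^r. *)
Definition subtorus (R : realType) (m r : nat) (H : set 'rV[cplx R]_m) : Prop :=
  H `<=` torus R m /\
  exists phi : 'rV[cplx R]_r -> 'rV[cplx R]_m,
    [/\ {within torus R r, continuous phi},
        (forall s t, torus R r s -> torus R r t ->
           phi (coord_mul s t) = coord_mul (phi s) (phi t)) &
        set_bij (torus R r) H phi].

Definition acts_freely (R : realType) (m : nat) (H X : set 'rV[cplx R]_m) :
    Prop :=
  forall t x, H t -> X x -> coord_mul t x = x -> t = const_mx 1.

Definition has_free_subtorus (R : realType) (m : nat) (K : {set {set 'I_m}})
    (r : nat) : Prop :=
  exists H : set 'rV[cplx R]_m,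
    subtorus r H /\ acts_freely H (moment_angle R K).

(* s(K) = r. *)
Definition buchstaber_number (R : realType) (m : nat) (K : {set {set 'I_m}})
    (r : nat) : Prop :=
  has_free_subtorus R K r /\
  forall r', has_free_subtorus R K r' -> (r' <= r)%N.

(* Main.v *)
(** A complex is described in Gale form, as the zero sets of the points of a
    simple polytope [{u >= 0 | \sum_i u i *: B i = g}] with [B i] in [R^p], together
    with integral vectors [A i] that generate [Z^p] when [i] ranges over the
    support of any point of that polytope; these are the exponents of a free
    [p]-torus. Duplicating columns of [B] realizes wedges, and adding a new
    coordinate to the columns realizes a stellar subdivision. Wedging a seed with
    parameters [(p, m)] at [s] vertices and then subdividing a face that contains
    exactly one vertex of each new pair gives a seed with parameters
    [(p + 1, m + s + 1)]; starting from the pentagon and the cyclic polytope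
    [C_4(7)], all the required parameters with [p >= 4] are reached. The remaining
    case [(p, m) = (3, 6)] is the octahedron.

    The complex spans a complete fan by linear programming duality. A common
    refinement of this fan with the fan of a simplex, cut into simplices by
    flags of cells, shows that the complex is a PL sphere. No torus of dimension
    greater than [p] acts freely, because of its 2-torsion. *)

Require Import Defs.
From HB Require Import structures.
From mathcomp Require Import all_boot all_order all_algebra.
From mathcomp Require Import complex.
From mathcomp Require Import all_classical all_reals all_analysis.
From mathcomp Require Import ring lra zify.

Set Implicit Arguments.
Unset Strict Implicit.
Unset Printing Implicit Defensive.

Import Order.TTheory GRing.Theory Num.Theory.
Import numFieldNormedType.Exports.
Local Open Scope ring_scope.

(** * Polytopes in Gale form *)

(** In a wedge the two vertices [v] and [v'] are interchangeable: a face that avoids both remains a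
    face when either one is added. Hence a nonface [N] that contains [i] but not [j], and becomes a
    face without [i], shows that [i] and [j] do not form such a pair; this is [distinguished].
    Duplicating columns creates interchangeable pairs. Cutting off the face [F] of the simple
    polytope separates them again: [F] becomes a nonface whose proper subsets are still faces, and
    it contains just one vertex of each pair.

    At most [m] columns are duplicated and one vertex is added, so [m] grows to at most [2m + 1];
    this is the recursion satisfied by [2 ^ p - 1]. Each step raises [p], so [p = 3] has to be
    settled by explicit tables. Opposite vertices of the octahedron are not [distinguished], but
    they span no edge, which excludes a wedge as well.

    [A] and [B] are linked only through the supports of feasible points. The polytope can therefore
    be realized over the reals while the torus is given by unrelated integral vectors. *)

(** A minimum over a finite type; all the small step lengths below are chosen with it. *)
Lemma uniform_pos (R : realFieldType) (T : finType) (Q : T -> R -> Prop) :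
  (forall t a b, 0 < b -> b <= a -> Q t a -> Q t b) ->
  (forall t, exists2 a, 0 < a & Q t a) ->
  exists2 a, 0 < a & forall t, Q t a.
Proof.
move=> mono ex.
suff [a a0 Qa] : exists2 a, 0 < a & forall t, t \in enum T -> Q t a.
  by exists a => // t; apply: Qa; rewrite mem_enum.
elim: (enum T) => [|t s [a a0 Qa]]; first by exists 1.
have [b b0 Qb] := ex t; exists (Num.min a b); first by rewrite lt_min a0.
move=> u; rewrite inE => /predU1P[->|us].
  by apply: mono Qb; rewrite ?lt_min ?a0 // ge_min lexx orbT.
by apply: mono (Qa u us); rewrite ?lt_min ?a0 // ge_min lexx.
Qed.

(** * Spanning families of columns over a commutative ring *)

Section Span.
Variables (S : comNzRingType) (I : finType) (p : nat) (A : I -> 'rV[S]_p).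
Variable T : {set I}.

Definition in_span (v : 'rV[S]_p) :=
  exists c : I -> S, v = \sum_(i in T) c i *: A i.

Lemma in_span_base i : i \in T -> in_span (A i).
Proof.
move=> iT; exists (fun j => (j == i)%:R).
rewrite (bigD1 i) //= eqxx scale1r big1 ?addr0 // => j /andP[_ /negbTE ->].
by rewrite scale0r.
Qed.

Lemma in_spanD u v : in_span u -> in_span v -> in_span (u + v).
Proof.
move=> [c ->] [d ->]; exists (fun i => c i + d i).
by rewrite -big_split; apply: eq_bigr => i _; rewrite scalerDl.
Qed.

Lemma in_spanZ a v : in_span v -> in_span (a *: v).
Proof.
move=> [c ->]; exists (fun i => a * c i).
by rewrite scaler_sumr; apply: eq_bigr => i _; rewrite scalerA.
Qed.

Lemma in_span_sum (J : finType) (P : pred J) (F : J -> 'rV[S]_p) :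
  (forall j, P j -> in_span (F j)) -> in_span (\sum_(j | P j) F j).
Proof.
move=> H; elim/big_ind: _ => //; last exact: in_spanD.
by exists (fun=> 0); rewrite big1 // => i _; rewrite scale0r.
Qed.

Definition spans := forall v, in_span v.

End Span.

Lemma spans_trans (S : comNzRingType) (I J : finType) p (A : I -> 'rV[S]_p)
    (A' : J -> 'rV[S]_p) (T : {set I}) (T' : {set J}) :
  spans A T -> (forall i, i \in T -> in_span A' T' (A i)) -> spans A' T'.
Proof.
move=> AT H v; have [c ->] := AT v.
by apply: in_span_sum => i iT; apply: in_spanZ; apply: H.
Qed.

Lemma spansS (S : comNzRingType) (I : finType) p (A : I -> 'rV[S]_p)
    (T T' : {set I}) : T \subset T' -> spans A T -> spans A T'.
Proof.
move=> /fintype.subsetP sT; move/spans_trans; apply => i /sT; exact: in_span_base.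
Qed.

Section Gale.
Variable R : realType.

Section Defs.
Variables (I : finType) (p : nat) (B : I -> 'rV[R]_p) (g : 'rV[R]_p).

(* The points of the simple polytope [{u >= 0 | \sum_i u i *: B i = g}]; the
   boundary complex of its polar has the zero sets of these points as faces. *)
Definition feasible (u : I -> R) :=
  (forall i, 0 <= u i) /\ \sum_i u i *: B i = g.

Definition face (s : {set I}) :=
  exists2 u, feasible u & forall i, (u i == 0) = (i \in s).

(** Stronger than not being a face: the coordinates on [N] never all drop to the margin. In this
    form it passes to duplicated columns and to blow-ups, with a smaller margin. *)
Definition nonface (d : R) (N : {set I}) :=
  forall u, feasible u -> exists2 i, i \in N & d < u i.

Definition distinguished d i j :=
  exists N : {set I}, [/\ i \in N, j \notin N, nonface d N & face (N :\ i)].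

(* [d] is a margin: coordinates of size at most [d] may be neglected. This
   keeps the condition stable under small changes of [g]. *)
Record gale (A : I -> 'rV[int]_p) (d : R) : Prop := Gale {
  gale_gt0 : 0 < d;
  gale_ge0 : forall i k, 0 <= A i 0 k;
  gale_bounded : exists l : 'cV[R]_p, forall i, 0 < (B i *m l) 0 0;
  gale_spanA : forall u, feasible u -> spans A [set i | d < u i];
  gale_spanB : forall u, feasible u -> spans B [set i | d < u i];
  gale_vertex : forall i, face [set i] }.

End Defs.

(* As the columns of the support span, the zeros of [u] outside [s] can be
   made positive at the expense of the support. *)
Lemma face_sub (I : finType) p (B : I -> 'rV[R]_p) g u (s : {set I}) :
  (forall u, feasible B g u -> spans B [set i | u i != 0]) -> feasible B g u ->
  (forall i, i \in s -> u i = 0) ->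
  face B g s.
Proof.
move=> spB fu us; have [u0 ug] := fu.
pose Z := [set i | u i == 0] :\: s.
have [c cE] := spB _ fu (\sum_(i in Z) B i).
pose w i := if u i == 0 then (i \in Z)%:R else - c i.
have w0 : \sum_i w i *: B i = 0.
  rewrite (bigID (fun i => u i == 0)) /=.
  have -> : \sum_(i | u i == 0) w i *: B i = \sum_(i in Z) B i.
    rewrite (bigID (mem Z)) /= [X in _ + X]big1 ?addr0.
      rewrite (eq_bigl (mem Z)) => [|i].
        apply: eq_bigr => i iZ.
        have ui : u i == 0 by move: iZ; rewrite !inE => /andP[].
        by rewrite /w ui (_ : i \in Z) ?scale1r.
      by rewrite !inE; case: (u i == 0); rewrite ?andbF.
    by move=> i /andP[ui iZ]; rewrite /w ui (_ : i \in Z = false) ?scale0r //; apply/negbTE.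
  have -> : \sum_(i | u i != 0) w i *: B i = - \sum_(i in Z) B i.
    rewrite cE -sumrN; apply: eq_big => [i|i ui]; first by rewrite inE.
    by rewrite /w (negbTE ui) scaleNr.
  by rewrite subrr.
have [t t0 H] : exists2 t, 0 < t & forall i, u i != 0 -> 0 < u i + t * w i.
  apply: uniform_pos => [i a b b0 ba H ui|i].
    have [wi|wi] := leP 0 (w i).
      by rewrite ltr_wpDr ?mulr_ge0 ?(ltW b0) // lt_def ui u0.
    by apply: lt_le_trans (H ui) _; rewrite lerD2l ler_wnM2r // ltW.
  have [->|ui] := eqVneq (u i) 0; first by exists 1.
  have ui0 : 0 < u i by rewrite lt_def ui u0.
  exists (u i / (1 + `|w i|)) => [|_].
    by rewrite divr_gt0 // ltr_pwDl.
  have := ler_norm (- w i); rewrite normrN => wN.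
  have n1 : 0 < 1 + `|w i| by rewrite ltr_pwDl.
  rewrite -[X in X + _](@divfK _ (1 + `|w i|)) ?gt_eqF // -mulrDr mulr_gt0 //.
    by rewrite divr_gt0.
  lra.
exists (fun i => u i + t * w i).
  split=> [i|].
    have [ui|ui] := eqVneq (u i) 0; last exact/ltW/H.
    by rewrite ui add0r mulr_ge0 ?(ltW t0) // /w ui eqxx ler0n.
  rewrite /=; under eq_bigr => i _ do rewrite scalerDl -scalerA.
  by rewrite big_split /= -scaler_sumr w0 scaler0 addr0.
move=> i; have [ui|ui] := eqVneq (u i) 0.
  rewrite ui add0r mulf_eq0 gt_eqF //= /w ui eqxx pnatr_eq0 eqb0 !inE ui eqxx.
  by rewrite andbT negbK.
by rewrite gt_eqF ?H //; apply/esym; apply/negbTE/negP => /us/eqP; apply/negP.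
Qed.

Section GaleTheory.
Variables (I : finType) (p : nat) (B : I -> 'rV[R]_p) (g : 'rV[R]_p).
Variables (A : I -> 'rV[int]_p) (d : R).
Hypothesis G : gale B g A d.

Lemma feasible_comb u v t : feasible B g u -> feasible B g v -> 0 <= t <= 1 ->
  feasible B g (fun i => (1 - t) * u i + t * v i).
Proof.
move=> [u0 ug] [v0 vg] /andP[t0 t1]; split.
  by move=> i; rewrite addr_ge0 ?mulr_ge0 ?subr_ge0.
under eq_bigr => i _ do rewrite scalerDl -!scalerA.
by rewrite big_split /= -!scaler_sumr ug vg -scalerDl subrK scale1r.
Qed.

Lemma spanB_supp u : feasible B g u -> spans B [set i | u i != 0].
Proof.
move=> fu; apply: spansS (gale_spanB G fu).
by apply/fintype.subsetP => i; rewrite !inE => /(lt_trans (gale_gt0 G))/lt0r_neq0.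
Qed.

Lemma spanA_supp u : feasible B g u -> spans A [set i | u i != 0].
Proof.
move=> fu; apply: spansS (gale_spanA G fu).
by apply/fintype.subsetP => i; rewrite !inE => /(lt_trans (gale_gt0 G))/lt0r_neq0.
Qed.

Lemma face_subset (s t : {set I}) : t \subset s -> face B g s -> face B g t.
Proof.
move=> /fintype.subsetP ts [u fu us]; apply: (face_sub spanB_supp fu) => i /ts.
by rewrite -us => /eqP.
Qed.

End GaleTheory.

(** * Duplicating columns *)

Section Pullback.
Variables (I J : finType) (p : nat) (B : I -> 'rV[R]_p) (g : 'rV[R]_p).
Variables (A : I -> 'rV[int]_p) (d : R) (pi : J -> I).
Hypothesis G : gale B g A d.
Hypothesis pi_surj : forall i, exists j, pi j = i.

Let push (u : J -> R) i := \sum_(j | pi j == i) u j.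
(** Pigeonhole: a fibre sum above [d] has at most [#|J|] terms, so one of them exceeds [d']. The
    successor keeps the denominator nonzero. *)
Let d' := d / #|J|.+1%:R.

Lemma feasible_push u : feasible (B \o pi) g u -> feasible B g (push u).
Proof.
move=> [u0 ug]; split=> [i|]; first exact: sumr_ge0.
rewrite -ug (partition_big pi xpredT) //=; apply: eq_bigr => i _.
by rewrite scaler_suml; apply: eq_bigr => j /eqP ->.
Qed.

Lemma push_gt u i : d < push u i -> exists2 j, pi j = i & d' < u j.
Proof.
move=> ui; apply: contrapT => H; move: ui; apply/negP; rewrite -leNgt.
have d0 := gale_gt0 G.
apply: (@le_trans _ _ (\sum_(j : J) d')).
  rewrite /push [leRHS](bigID (fun j => pi j == i)) /= ler_wpDr //.
    by apply: sumr_ge0 => j _; rewrite divr_ge0 ?ltW.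
  apply: ler_sum => j /eqP ji; rewrite leNgt; apply/negP => uj.
  by apply: H; exists j.
rewrite sumr_const -[X in X <= _]mulr_natr /d' mulrAC ler_pdivrMr ?ltr0n //.
by rewrite ler_pM2l // ler_nat.
Qed.

(** A coordinate downstairs must vanish only if its whole fibre lies in [W]. Otherwise its value is
    shared equally among the elements of the fibre outside [W], of which there are [c i]. *)
Lemma face_pull (W : {set J}) :
  face B g [set i | [forall j, (pi j == i) ==> (j \in W)]] ->
  face (B \o pi) g W.
Proof.
move=> [u [u0 ug] us].
pose c i := #|[set j | (pi j == i) && (j \notin W)]|.
have c0 i : (c i == 0)%N = (u i == 0).
  rewrite us inE cards_eq0; apply/eqP/forallP => [H j|H].
    by apply/implyP => ji; move/setP/(_ j): H; rewrite !inE ji /= => /negbFE.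
  apply/setP => j; rewrite !inE; apply/negbTE; rewrite negb_and negbK.
  by rewrite -implybE.
exists (fun j => if j \in W then 0 else u (pi j) / (c (pi j))%:R).
  split=> [j|]; first by case: ifP => // _; rewrite divr_ge0.
  rewrite (partition_big pi xpredT) //= -ug; apply: eq_bigr => i _.
  have [ui|ui] := eqVneq (u i) 0.
    rewrite ui scale0r big1 // => j /eqP ->; rewrite ui mul0r.
    by rewrite if_same scale0r.
  rewrite (eq_bigr (fun j => (if j \in W then 0 else u i / (c i)%:R) *: B i));
    last by move=> j /eqP /= ->.
  rewrite -scaler_suml; congr (_ *: _).
  rewrite (bigID (mem W)) /= [X in X + _]big1 ?add0r; last first.
    by move=> j /andP[_ ->].
  rewrite (eq_bigr (fun=> u i / (c i)%:R)); last first.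
    by move=> j /andP[_ /negbTE ->].
  rewrite sumr_const (_ : #|_| = c i).
    rewrite -[LHS]mulr_natr divfK // pnatr_eq0 c0 //.
  by apply: eq_card => j; rewrite !inE.
move=> j; case: (boolP (j \in W)) => jW; rewrite ?eqxx //.
rewrite mulf_eq0 invr_eq0 pnatr_eq0 c0 orbb us inE; apply/negbTE/negP.
by move/forallP/(_ j); rewrite eqxx (negbTE jW).
Qed.

Lemma nonface_pull (N : {set I}) :
  nonface B g d N -> nonface (B \o pi) g d' (pi @^-1: N)%SET.
Proof.
move=> nN u /feasible_push /nN[i iN /push_gt[j ji uj]]; exists j => //.
by rewrite inE ji.
Qed.

Lemma gale_pull : gale (B \o pi) g (A \o pi) d'.
Proof.
split=> [|i k||u fu|u fu|j].
- by rewrite divr_gt0 ?ltr0n // (gale_gt0 G).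
- exact: gale_ge0 G _ _.
- by have [l lB] := gale_bounded G; exists l => j; apply: lB.
- apply: spans_trans (gale_spanA G (feasible_push fu)) _ => i.
  rewrite inE => /push_gt[j <- uj].
  by apply: (@in_span_base _ _ _ (A \o pi)); rewrite inE.
- apply: spans_trans (gale_spanB G (feasible_push fu)) _ => i.
  rewrite inE => /push_gt[j <- uj].
  by apply: (@in_span_base _ _ _ (B \o pi)); rewrite inE.
- apply: face_pull; apply: (face_subset G) (gale_vertex G (pi j)).
  apply/fintype.subsetP => i; have [j0 <-] := pi_surj i.
  by rewrite !inE => /forallP/(_ j0); rewrite eqxx inE => /eqP ->.
Qed.

(** The full preimage of [N] works: removing the single element [j1] already breaks the fibre of
    [pi j1], so only fibres over [N :\ pi j1] remain complete. *)
Lemma distinguished_pull j1 j2 : distinguished B g d (pi j1) (pi j2) ->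
  distinguished (B \o pi) g d' j1 j2.
Proof.
move=> [N [N1 N2 nN fN]]; exists (pi @^-1: N)%SET; split.
- by rewrite inE.
- by rewrite inE.
- exact: nonface_pull.
- apply: face_pull; apply: (face_subset G) fN.
  apply/fintype.subsetP => i; have [j0 <-] := pi_surj i.
  rewrite !inE => /forallP H; have := H j0; rewrite eqxx !inE => /andP[_ ->].
  rewrite andbT; apply/eqP => ij; have := H j1.
  by rewrite ij eqxx !inE eqxx.
Qed.

End Pullback.

(** * Cutting off a face *)

Section BlowUp.
Variables (J : finType) (p : nat) (B : J -> 'rV[R]_p) (g : 'rV[R]_p).
Variables (A : J -> 'rV[int]_p) (d : R) (F : {set J}).
Hypothesis G : gale B g A d.

(** Used with [e = -1] for [B], where the new column is a slack variable, and with [e = 1] for [A],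
    where the exponents have to stay nonnegative. *)
Definition blow_up (S : comNzRingType) (C : J -> 'rV[S]_p) (e : S)
    (o : option J) : 'rV[S]_(p + 1) :=
  if o is Some j then row_mx (C j) (const_mx (j \in F)%:R)
  else row_mx 0 (const_mx e).

(** Either the new column is available and clears all last coordinates, or [T] avoids [F], so that
    its columns lift with last coordinate zero and one column of [F] supplies the missing
    direction. *)
Lemma blow_up_span (S : comNzRingType) (C : J -> 'rV[S]_p) e (T : {set J})
    (T' : {set option J}) :
  e * e = 1 -> spans C T -> (forall j, j \in T -> Some j \in T') ->
  None \in T' \/ [disjoint T & F] /\ (exists2 f, f \in F & Some f \in T') ->
  spans (blow_up C e) T'.
Proof.
move=> ee CT TT' H v.
suff [H1 H2] : (forall v1 : 'rV_p, in_span (blow_up C e) T' (row_mx v1 0)) /\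
    in_span (blow_up C e) T' (row_mx 0 (const_mx 1)).
  rewrite -[v]hsubmxK (_ : row_mx _ _ = row_mx (lsubmx v) 0 +
      rsubmx v 0 0 *: row_mx 0 (const_mx 1)); first last.
    rewrite scale_row_mx add_row_mx scaler0 addr0 add0r; congr row_mx.
    by apply/rowP => i; rewrite !mxE mulr1 ord1.
  by apply: in_spanD (H1 _) _; apply: in_spanZ.
have base o : o \in T' -> in_span (blow_up C e) T' (blow_up C e o).
  exact: in_span_base.
have lift (K : forall j, j \in T -> in_span (blow_up C e) T' (row_mx (C j) 0)) v1 :
    in_span (blow_up C e) T' (row_mx v1 0).
  have [c ->] := CT v1; rewrite (_ : row_mx _ _ =
      \sum_(i in T) c i *: row_mx (C i) 0).
    by apply: in_span_sum => j jT; apply: in_spanZ; apply: K.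
  rewrite (big_morph (fun x : 'rV[S]_p => row_mx x (0 : 'rV[S]_1))
    (id1 := 0) (op1 := +%R)).
  - by apply: eq_bigr => i _; rewrite scale_row_mx scaler0.
  - by move=> x y; rewrite add_row_mx addr0.
  - by rewrite row_mx0.
case: H => [NT|[disj [f fF fT]]].
  have N1 : in_span (blow_up C e) T' (row_mx 0 (const_mx 1)).
    have := in_spanZ e (base _ NT); rewrite /= scale_row_mx scaler0.
    suff -> : e *: const_mx e = const_mx 1 :> 'rV_1 by [].
    by apply/rowP => i; rewrite !mxE.
  split=> //; apply: lift => j jT.
  rewrite (_ : row_mx _ _ = blow_up C e (Some j) +
    (- (j \in F)%:R) *: row_mx 0 (const_mx 1)).
    by apply: in_spanD; [apply/base/TT' | apply: in_spanZ].
  rewrite /= scale_row_mx add_row_mx scaler0 addr0; congr row_mx.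
  by apply/rowP => i; rewrite !mxE mulr1 subrr.
have K : forall v1 : 'rV_p, in_span (blow_up C e) T' (row_mx v1 0).
  apply: lift => j jT.
  suff <- : blow_up C e (Some j) = row_mx (C j) 0 by apply/base/TT'.
  rewrite /= (disjointFr disj jT); congr row_mx.
split=> //; rewrite (_ : row_mx _ _ = blow_up C e (Some f) + (-1) *: row_mx (C f) 0).
  by apply: in_spanD; [exact: base | exact/in_spanZ/K].
rewrite /= fF scale_row_mx add_row_mx scaler0 addr0 scaleN1r subrr.
by congr row_mx; apply/rowP => i; rewrite !mxE.
Qed.


Let G' (e : R) : 'rV[R]_(p + 1) := row_mx g (const_mx e).

(** [u None] is the slack of the inequality [\sum_(j in F) u j >= e], which truncates the simple
    polytope at the face [F]. Truncation is polar to stellar subdivision, with [None] as the new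
    vertex. *)
Lemma feasible_blow_up e u : feasible (blow_up B (-1)) (G' e) u <->
  [/\ feasible B g (fun j => u (Some j)), 0 <= u None &
      \sum_(j in F) u (Some j) = e + u None].
Proof.
have E : \sum_o u o *: blow_up B (-1) o =
    row_mx (\sum_j u (Some j) *: B j)
      (const_mx (\sum_(j in F) u (Some j) - u None)).
  rewrite (bigD1 None) //= (reindex_omap Some id) /=; last by case.
  rewrite (eq_bigl xpredT) => [|j]; last by rewrite eqxx.
  rewrite (eq_bigr (fun j => row_mx (u (Some j) *: B j)
      (const_mx (u (Some j) * (j \in F)%:R)))) => [|j _]; last first.
    by rewrite scale_row_mx scalemx_const.
  rewrite scale_row_mx scaler0 scalemx_const mulrN1.
  have M : forall (r : seq J), \sum_(j <- r) row_mx (u (Some j) *: B j)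
      (const_mx (u (Some j) * (j \in F)%:R) : 'rV_1) =
      row_mx (\sum_(j <- r) u (Some j) *: B j)
        (const_mx (\sum_(j <- r) u (Some j) * (j \in F)%:R)).
    elim=> [|j r IH]; first by rewrite !big_nil -row_mx0.
    by rewrite !big_cons IH add_row_mx -raddfD.
  rewrite M add_row_mx add0r -raddfD addrC; congr (row_mx _ (const_mx (_ - _))).
  rewrite [RHS]big_mkcond; apply: eq_bigr => j _.
  by case: (j \in F); rewrite ?mulr1 ?mulr0.
split=> [[u0]|[[u0 ug] uN uF]].
  rewrite E => /eq_row_mx[ug /rowP/(_ 0)]; rewrite !mxE => uF.
  by split=> //; rewrite -uF subrK.
split=> [[j|]|] //; rewrite E ug uF addrK //.
Qed.

Let pre (s : {set option J}) := [set j | Some j \in s].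

(** A shallow cut produces the combinatorics of a stellar subdivision: no face contains [F], and a
    set containing [None] is a face only if adding [F] to its old part gives an old face. The last
    two clauses are criteria for faces and for nonfaces. *)
Lemma gale_blow_up : face B g F -> (1 < #|F|)%N ->
  exists g' d', [/\ gale (blow_up B (-1)) g' (blow_up A 1) d',
    (forall s : {set option J},
       face B g (if None \in s then pre s :|: F else pre s) ->
       ~~ (F \subset pre s) -> face (blow_up B (-1)) g' s) &
    forall N, F \subset pre N \/
       nonface B g d (if None \in N then pre N :|: F else pre N) ->
       nonface (blow_up B (-1)) g' d' N].
Proof.
move=> fF F1; have d0 := gale_gt0 G.
have [h h0 hface] : exists2 h, 0 < h & forall s : {set J}, face B g s ->
    exists2 u, feasible B g u & forall i, if i \in s then u i = 0 else h < u i.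
  apply: uniform_pos => [s a b b0 ba H /H[u fu us]|s].
    exists u => // i; have := us i; case: ifP => // _; exact: le_lt_trans.
  have [[u fu us]|nf] := pselect (face B g s); last by exists 1.
  have [t t0 ht] : exists2 t, 0 < t & forall i, i \notin s -> t < u i.
    apply: uniform_pos => [i a b b0 ba H /H|i]; first exact: le_lt_trans.
    have [is_|is_] := boolP (i \in s); first by exists 1.
    have ui : 0 < u i by rewrite lt_def us is_ /=; case: fu.
    by exists (u i / 2) => [|_]; rewrite ?divr_gt0 // ltr_pdivrMr // ltr_pMr // ltr1n.
  exists t => // _; exists u => // i; case: ifP => [|/negbT]; last exact: ht.
  by rewrite -us => /eqP.
(* Since [e <= h], the cut misses the chosen points of faces not containing [F]. Since [2e <= d], a
   slack of at most [e] keeps the sum over [F] within the old margin. *)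
pose e := Num.min d h / 2.
have m0 : 0 < Num.min d h by rewrite lt_min d0.
have e0 : 0 < e by rewrite divr_gt0.
have eh : e <= h.
  by rewrite ler_pdivrMr // (le_trans (_ : _ <= h)) ?ge_min ?lexx ?orbT // ler_pMr // ler1n.
have ed : e + e <= d by rewrite -splitr ge_min lexx.
pose d' := e / #|J|.+1%:R.
have d'0 : 0 < d' by rewrite divr_gt0 // ltr0n.
have d'e : d' <= e by rewrite ler_pdivrMr ?ltr0n // ler_pMr // ler1n.
have d'd : d' <= d by lra.
(* Either the new coordinate exceeds the margin, or all those in [F] are
   below the old margin. *)
have small u : feasible (blow_up B (-1)) (G' e) u -> u None <= d' ->
    forall j, j \in F -> u (Some j) <= d.
  move=> /feasible_blow_up[[u0 _] _ uF] uN j jF.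
  have : u (Some j) <= \sum_(i in F) u (Some i).
    by rewrite (bigD1 j) //= ler_wpDr // sumr_ge0.
  by rewrite uF; lra.
have large u : feasible (blow_up B (-1)) (G' e) u ->
    exists2 j, j \in F & d' < u (Some j).
  move=> /feasible_blow_up[[u0 _] uN uF]; apply: contrapT => H.
  have : \sum_(j in F) u (Some j) <= \sum_(j : J) d'.
    rewrite [leRHS](bigID (mem F)) /= ler_wpDr //.
      by apply: sumr_ge0 => j _; exact: ltW.
    apply: ler_sum => j jF; rewrite leNgt; apply/negP => uj.
    by apply: H; exists j.
  apply/negP; rewrite -ltNge uF sumr_const -[X in X < _]mulr_natr.
  rewrite (@lt_le_trans _ _ e) ?lerDl // /d' mulrAC ltr_pdivrMr ?ltr0n //.
  by rewrite ltr_pM2l // ltr_nat.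
have facep (s : {set option J}) : face B g (if None \in s then pre s :|: F else pre s) ->
    ~~ (F \subset pre s) -> face (blow_up B (-1)) (G' e) s.
  move=> fs /subsetPn[f fF' fs']; case: ifP fs => [Ns fs|/negbT Ns fs].
    have [u fu us] := fs.
    have [v fv vs] := hface _ (face_subset G (finset.subsetUl _ _) fs).
    have uF j : j \in F -> u j = 0.
      by move=> jF; apply/eqP; rewrite us inE jF orbT.
    have v0 : forall j, 0 <= v j by case: fv.
    have vf : h < v f by have := vs f; rewrite (negbTE fs').
    have vF : e < \sum_(j in F) v j.
      rewrite (bigD1 f) //= ltr_wpDr ?sumr_ge0 //; exact: le_lt_trans vf.
    have vF0 : 0 < \sum_(j in F) v j by apply: lt_trans vF.
    (* The segment from [u], which vanishes on [F], to [v], which lies beyond the cut, meets the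
       cutting hyperplane at this parameter. *)
    pose t := e / \sum_(j in F) v j.
    have t0 : 0 < t by rewrite divr_gt0.
    have t1 : t < 1 by rewrite ltr_pdivrMr // mul1r.
    have fw := feasible_comb fu fv (_ : 0 <= t <= 1).
    exists (fun o => if o is Some j then (1 - t) * u j + t * v j else 0).
      apply/feasible_blow_up; split=> //; first by apply: fw; rewrite !ltW.
      rewrite addr0 (eq_bigr (fun j => t * v j)).
        by rewrite -mulr_sumr divfK // gt_eqF.
      by move=> j /uF ->; rewrite mulr0 add0r.
    move=> [j|]; last by rewrite eqxx.
    have := vs j; rewrite inE; case: (boolP (Some j \in s)) => js vj.
      have -> : u j = 0 by apply/eqP; rewrite us !inE js.
      by rewrite vj !mulr0 addr0 eqxx.
    have uj : 0 <= u j by case: fu.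
    have vj0 : 0 < v j by exact: lt_trans h0 vj.
    rewrite gt_eqF //; apply: ltr_wpDl; last exact: mulr_gt0.
    by apply: mulr_ge0 => //; rewrite subr_ge0 ltW.
  have [u fu us] := hface _ fs.
  have u0 : forall j, 0 <= u j by case: fu.
  have uF : e < \sum_(j in F) u j.
    rewrite (bigD1 f) //= ltr_wpDr ?sumr_ge0 //.
    by have := us f; rewrite (negbTE fs'); exact: le_lt_trans.
  exists (fun o => if o is Some j then u j else \sum_(j in F) u j - e).
    apply/feasible_blow_up; split=> //; first by rewrite subr_ge0 ltW.
    by rewrite addrC subrK.
  move=> [j|]; last by rewrite (negbTE Ns) gt_eqF // subr_gt0.
  have := us j; rewrite inE; case: ifP => _ uj; first by rewrite uj eqxx.
  by rewrite gt_eqF // (lt_trans h0).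
exists (G' e), d'; split=> //.
- have disj u : feasible (blow_up B (-1)) (G' e) u ->
      None \in [set o | d' < u o] \/
      [disjoint [set i | d < u (Some i)] & F] /\
      (exists2 f, f \in F & Some f \in [set o | d' < u o]).
    move=> fu; rewrite inE; have [|uN] := ltP d' (u None); [by left|right].
    split; last by have [f fF' uf] := large u fu; exists f; rewrite ?inE.
    apply/pred0P => j /=; rewrite inE; apply/negbTE/negP => /andP[uj jF].
    by have := small u fu uN j jF; rewrite leNgt uj.
  have sub (u : option J -> R) j :
      j \in [set i | d < u (Some i)] -> Some j \in [set o | d' < u o].
    by rewrite !inE; apply: le_lt_trans.
  split=> //.
  + move=> [j|] k; rewrite /blow_up mxE; case: fintype.splitP => i _; rewrite ?mxE //.
    exact: gale_ge0 G _ _.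
  + have [l lB] := gale_bounded G.
    have [t t0 ht] : exists2 t, 0 < t & forall j, t < (B j *m l) 0 0.
      apply: uniform_pos => [j a b _ ba|j]; first exact: le_lt_trans.
      exists ((B j *m l) 0 0 / 2); first by rewrite divr_gt0.
      by rewrite ltr_pdivrMr // ltr_pMr // ltr1n.
    (* The new column ends in -1, so the functional needs a negative last entry, smaller in size
       than all its old values. *)
    exists (col_mx l (const_mx (- t))) => -[j|]; rewrite mul_row_col.
      rewrite mxE [X in _ + X]mxE big_ord1 !mxE.
      have := ht j; rewrite mxE; case: (j \in F) => H; first by rewrite mul1r subr_gt0.
      by rewrite mul0r addr0 (lt_trans t0).
    by rewrite mul0mx add0r mxE big_ord1 !mxE mulrNN mul1r.
  + move=> u fu; have /feasible_blow_up[fu' _ _] := fu.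
    by apply: blow_up_span (gale_spanA G fu') (sub u) (disj u fu); rewrite mulr1.
  + move=> u fu; have /feasible_blow_up[fu' _ _] := fu.
    by apply: blow_up_span (gale_spanB G fu') (sub u) (disj u fu); rewrite mulrNN mulr1.
  + have preS j : pre [set Some j] = [set j] by apply/setP => i; rewrite !inE.
    have preN : pre [set None] = finset.set0 by apply/setP => i; rewrite !inE.
    have big j : ~~ (F \subset [set j]).
      apply: contraL F1 => /subset_leq_card; rewrite cards1 -leqNgt; exact.
    move=> [j|]; apply: facep; rewrite ?preS ?preN ?big // ?inE /=.
    * exact: gale_vertex G _.
    * by rewrite finset.set0U.
    * by rewrite finset.subset0 -cards_eq0 -lt0n ltnW.
- move=> N nN u fu; case: nN => [/fintype.subsetP FN|nN].
    by have [j /FN] := large u fu; rewrite inE => ? ?; exists (Some j).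
  have /feasible_blow_up[fu' _ _] := fu.
  have [j jN uj] := nN _ fu'; have [uN|uN] := ltP d' (u None).
    case: ifP jN => [NN _|NN]; first by exists None.
    by rewrite inE => jN; exists (Some j) => //; exact: le_lt_trans uj.
  exists (Some j); last exact: le_lt_trans uj.
  case: ifP jN => _; rewrite !inE // => /orP[//|jF].
  by have := small u fu uN j jF; rewrite leNgt uj.
Qed.

End BlowUp.

End Gale.

(** * Doubling vertices and blowing up *)

Section Step.
Variable R : realType.

(* Seeds in Gale form: no two vertices are interchangeable in all nonfaces. *)
Definition seed_gale (p m : nat) := exists (I : finType) (B : I -> 'rV[R]_p)
    (g : 'rV[R]_p) (A : I -> 'rV[int]_p) (d : R),
  [/\ #|I| = m, gale B g A d,
      forall i j, i != j -> distinguished B g d i j \/ distinguished B g d j i &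
      exists i j, i != j /\ face B g [set i; j]].

(** Vertices in different fibres are separated before the blow-up and remain so ([lift]). Vertices
    in the same fibre are separated by [F] ([Fsep]). The new vertex is handled in [sepN]. *)
Lemma distinguished_blow_up (I J : finType) p (B : I -> 'rV[R]_p) g A d
    (pi : J -> I) (F : {set J}) :
  gale B g A d -> (forall i, exists j, pi j = i) ->
  (forall i j, i != j -> distinguished B g d i j \/ distinguished B g d j i) ->
  face (B \o pi) g F ->
  (1 < #|F|)%N ->
  (forall j1 j2, j1 != j2 -> pi j1 = pi j2 -> (j1 \in F) = ~~ (j2 \in F)) ->
  seed_gale (p + 1) #|J|.+1.
Proof.
move=> GI surj sepI fF F1 FF.
pose d1 := d / #|J|.+1%:R.
have GJ : gale (B \o pi) g (A \o pi) d1 by exact: gale_pull.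
have sepJ j1 j2 : pi j1 != pi j2 ->
    distinguished (B \o pi) g d1 j1 j2 \/ distinguished (B \o pi) g d1 j2 j1.
  by move=> /sepI[H|H]; [left|right]; exact: (distinguished_pull GI surj H).
have [g' [d' [G' face' nonface']]] := gale_blow_up GJ fF F1.
set B' := blow_up _ _ _ in G' face' nonface'.
pose opt b (s : {set J}) : {set option J} :=
  [set o | if o is Some j then j \in s else b].
have preK b (s : {set J}) : [set j | Some j \in opt b s] = s.
  by apply/setP => j; rewrite !inE.
have optN b (s : {set J}) : (None \in opt b s) = b by rewrite inE.
have optD b (s : {set J}) j : opt b s :\ Some j = opt b (s :\ j).
  by apply/setP => -[k|]; rewrite !inE.
have optDN b (s : {set J}) : opt b s :\ None = opt false s.
  by apply/setP => -[k|]; rewrite !inE.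
have FD j (s : {set J}) : j \in F -> j \notin s -> ~~ (F \subset s).
  by move=> jF; apply: contra => /fintype.subsetP/(_ _ jF).
have FDD (N : {set J}) : ~~ (F \subset N :\: F).
  have /card_gt0P[f fF'] := ltnW F1.
  by apply: (FD f) => //; rewrite !inE fF'.
(* Separating nonfaces lift, with the part inside [F] replaced by the new
   vertex when necessary. *)
have lift j1 j2 : distinguished (B \o pi) g d1 j1 j2 ->
    distinguished B' g' d' (Some j1) (Some j2).
  move=> [N [N1 N2 nN fN]]; have [FN|FN] := boolP (F \subset N :\ j1).
    have j1F : j1 \notin F.
      by apply/negP => /(fintype.subsetP FN); rewrite !inE eqxx.
    have NF : N :\: F :|: F = N.
      apply/setP => j; rewrite !inE; case: (boolP (j \in F)) => jF; last by rewrite orbF.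
      by have := fintype.subsetP FN _ jF; rewrite !inE => /andP[_ ->].
    have NF1 : (N :\: F) :\ j1 :|: F = N :\ j1.
      rewrite -{2}NF; apply/setP => j; rewrite !inE.
      by have [->|] := eqVneq j j1; rewrite ?(negbTE j1F).
    exists (opt true (N :\: F)); split; rewrite ?inE ?j1F ?N1 ?(negbTE N2) ?andbF //.
      apply: nonface'; right.
      by rewrite ?optN preK NF.
    rewrite optD; apply: face'; rewrite ?optN preK ?NF1 //.
    by apply: contra (FDD N) => /fintype.subset_trans; apply; exact: subD1set.
  exists (opt false N); split; rewrite ?inE //.
    by apply: nonface'; right; rewrite ?optN preK.
  by rewrite optD; apply: face'; rewrite ?optN preK.
have Fsep j o : j \in F -> o \notin opt false F -> distinguished B' g' d' (Some j) o.
  move=> jF oF; exists (opt false F); split; rewrite ?inE //.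
  - by move: oF; rewrite inE.
  - by apply: nonface'; left; rewrite preK.
  - rewrite optD; apply: face'; rewrite ?optN preK.
      by apply: (face_subset GJ) fF; exact: subD1set.
    by apply: (FD j) => //; rewrite !inE eqxx.
have sepN j : distinguished B' g' d' (Some j) None \/ distinguished B' g' d' None (Some j).
  have [jF|jF] := boolP (j \in F); first by left; apply: Fsep; rewrite ?inE.
  (* [F] has two elements, and by [FF] they cannot both lie in the fibre of [pi j]. *)
  have [k kF kj] : exists2 k, k \in F & pi k != pi j.
    have /card_gt1P[a [b [aF bF ab]]] := F1.
    have [aj|aj] := eqVneq (pi a) (pi j); last by exists a.
    have [bj|bj] := eqVneq (pi b) (pi j); last by exists b.
    have := FF a b ab (etrans aj (esym bj)); by rewrite aF bF.
  have [[N [N1 N2 nN fN]]|[N [N1 N2 nN fN]]] := sepJ _ _ kj.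
    right; exists (opt true (N :\: F)); split; rewrite ?inE ?negb_and ?N2 ?orbT //.
      apply: nonface'; right; rewrite ?optN preK => u /nN[i iN ui]; exists i => //.
      by rewrite !inE iN andbT orbC; case: (i \in F).
    rewrite optDN; apply: face'; rewrite ?optN preK //.
    apply: (face_subset GJ) fN; apply/fintype.subsetP => i; rewrite !inE.
    by case/andP=> iF ->; rewrite andbT; apply: contraNneq iF => ->.
  left; exists (opt false N); split; rewrite ?inE //.
    by apply: nonface'; right; rewrite ?optN preK.
  rewrite optD; apply: face'; rewrite ?optN preK //; apply: (FD k) => //.
  by rewrite !inE negb_and N2 orbT.
exists (option J), B', g', (blow_up F (A \o pi) 1), d'; split=> //.
- by rewrite card_option.
- move=> [j1|] [j2|] // j12; last by have [] := sepN j2; [right|left].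
    have {}j12 : j1 != j2 by apply: contra j12 => /eqP ->.
    have [pj|/sepJ[]] := eqVneq (pi j1) (pi j2); last 2 first.
    + by left; apply: lift.
    + by right; apply: lift.
    have := FF _ _ j12 pj; have [j2F|j2F] := boolP (j2 \in F) => j1F.
      by right; apply: Fsep; rewrite ?inE ?j1F.
    by left; apply: Fsep; rewrite ?inE ?j1F.
have /card_gt1P[a [b [aF bF ab]]] := F1.
(* The new vertex is joined to each vertex of [F]; this is the edge needed for the next step. *)
exists None, (Some a); split=> //.
have -> : [set None; Some a] = opt true [set a].
  by apply/setP => -[j|]; rewrite !inE.
apply: face'; rewrite ?optN preK.
  rewrite (_ : _ :|: _ = F) //; apply/setP => i; rewrite !inE.
  by have [->|] := eqVneq i a.
by apply: (FD b) => //; rewrite inE eq_sym.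
Qed.

(** [F] consists of the new copies [inr k] and of those ends of the edge [ab] that are not
    duplicated. A fibre inside [F] is then a single end of the edge, so [F] is a face. The edge
    guarantees two elements of [F], even for [s = 0]. *)
Lemma seed_gale_step p m s : (s <= m)%N -> seed_gale p m ->
  seed_gale p.+1 (m + s).+1.
Proof.
move=> sm [I [B [g [A [d [Im G sep [a [b [ab fab]]]]]]]]].
have sI : (s <= #|I|)%N by rewrite Im.
pose h (k : 'I_s) : I := enum_val (widen_ord sI k).
have h_inj : injective h.
  by move=> k l /enum_val_inj/(congr1 val) /= kl; apply: val_inj.
pose pi (j : I + 'I_s) := match j with inl i => i | inr k => h k end.
pose F := [set j | match j : I + 'I_s with
  | inl i => (i \in [set a; b]) && (i \notin codom h) | inr k => true end].
have surj i : exists j, pi j = i by exists (inl i).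
rewrite -addn1 (_ : (m + s)%N = #|{: I + 'I_s}|); last by rewrite card_sum card_ord Im.
apply: (distinguished_blow_up (F := F) G surj sep).
- apply: face_pull; apply: (face_subset G) fab; apply/fintype.subsetP => i.
  by rewrite inE => /forallP/(_ (inl i)); rewrite eqxx inE => /andP[].
- have rep x : x \in [set a; b] -> exists2 j, j \in F & pi j = x.
    move=> xab; have [/codomP[k xk]|xc] := boolP (x \in codom h).
      by exists (inr k); rewrite ?inE.
    by exists (inl x); rewrite // inE xab.
  have [ja jaF pa] := rep a (set21 a b); have [jb jbF pb] := rep b (set22 a b).
  apply/card_gt1P; exists ja, jb; split=> //; apply: contraNneq ab => jab.
  by rewrite -pa -pb jab.
- move=> [i|k] [j|l]; rewrite ?inE //=.
  + by move=> ij e; rewrite e eqxx in ij.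
  + by move=> _ ->; rewrite codom_f andbF.
  + by move=> _ <-; rewrite codom_f andbF.
  + by move=> kl /h_inj e; rewrite e eqxx in kl.
Qed.

End Step.

(** * Small cases *)

Section Table.

Definition entry (t : seq (seq int)) (i k : nat) : int := nth 0 (nth [::] t i) k.

Definition table_rows (S : comNzRingType) (m : nat) (t : seq (seq int))
    (i : 'I_m) : 'rV[S]_3 := \row_(k < 3) (entry t i k)%:~R.

Definition det3 (S : comNzRingType) (x y z : nat -> S) : S :=
  x 0%N * (y 1%N * z 2%N - y 2%N * z 1%N) - x 1%N * (y 0%N * z 2%N - y 2%N * z 0%N)
  + x 2%N * (y 0%N * z 1%N - y 1%N * z 0%N).

(** Cramer's rule. Over [int] the inverse [e] is the determinant itself, which is 1 or -1. *)
Lemma spans_det3 (S : comNzRingType) m t (x y z : 'I_m) (T : {set 'I_m}) (e : S) :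
  x \in T -> y \in T -> z \in T ->
  e * (det3 (entry t x) (entry t y) (entry t z))%:~R = 1 ->
  spans (table_rows S t) T.
Proof.
move=> xT yT zT; rewrite /det3 !(rmorphD, rmorphN, rmorphM) /= => eD v.
pose f (w : 'I_m) k : S := (entry t w k)%:~R; pose g k := v 0 (inord k).
rewrite (_ : v = (e * det3 g (f y) (f z)) *: table_rows S t x
  + (e * det3 (f x) g (f z)) *: table_rows S t y
  + (e * det3 (f x) (f y) g) *: table_rows S t z).
  by do !apply: in_spanD; apply: in_spanZ; apply: in_span_base.
apply/rowP => k; rewrite !mxE -[LHS]mul1r -[X in X * _ = _]eD /det3 -/(f x k) -/(f y k) -/(f z k).
have -> : v 0 k = g k by rewrite /g inord_val.
by case: k => -[|[|[|//]]] ?; rewrite /f /=; ring.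
Qed.

(** A certificate for a small example. [tb] and [ta] list the columns and [Ns] lists nonfaces. [Ts]
    lists triples, one of which lies in every set that meets all of [Ns]. [Ss] lists integral
    solutions, feasible after division by their total. Real unknowns occur only in [hit], which is
    left to linear arithmetic. *)
Variables (R : realType) (m : nat) (tb ta : seq (seq int)).
Variables (Ns Ts : seq (seq nat)) (Ss : seq (seq nat)) (d : R).
Let g : 'rV[R]_3 := \row_k (k == 0)%:R.
Let B : 'I_m -> 'rV[R]_3 := table_rows R tb.
Let A : 'I_m -> 'rV[int]_3 := table_rows int ta.
Let zeros (s : seq nat) i := nth 0 s i == 0.
Let total (s : seq nat) := foldr (fun i z => nth 0 s i + z) 0 (iota 0 m).

Hypothesis d0 : 0 < d.
Hypothesis ta0 : forall i k, 0 <= entry ta i k.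
Hypothesis tb1 : all (fun i => entry tb i 0 == 1) (iota 0 m).
Hypothesis hit : forall v : nat -> R, (forall i, 0 <= v i) ->
  (forall k : 'I_3, \sum_(i < m) v i * (entry tb i k)%:~R = (k == 0)%:R) ->
  all (has (fun i => d < v i)) Ns.
Hypothesis Ts_m : all (all (fun i => i < m)%N) Ts.
Hypothesis Ns_m : all (all (fun i => i < m)%N) Ns.
Hypothesis hitting : forall b : nat -> bool, all (has b) Ns -> has (all b) Ts.
Hypothesis Ts_det : all (fun t =>
  let D u := det3 (entry u (nth 0 t 0)) (entry u (nth 0 t 1))
    (entry u (nth 0 t 2)) in
  [&& size t == 3%N, D ta * D ta == 1 & D tb != 0]) Ts.
Hypothesis Ss_sol : all (fun s : seq nat => (0 < total s)%N &&
  all (fun k => foldr (fun i z => (nth 0 s i)%:Z * entry tb i k + z) 0 (iota 0 m)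
     == 0) [:: 1; 2]%N) Ss.
Hypothesis Ss_vert : all (fun i => has (fun s => zeros s i) Ss) (iota 0 m).

Lemma foldr_iota (S : nmodType) (F : nat -> S) :
  foldr (fun i z => F i + z) 0 (iota 0 m) = \sum_(i < m) F i.
Proof.
rewrite -(big_mkord xpredT F) /index_iota subn0.
by elim: (iota 0 m) => [|a s IH]; rewrite ?big_nil ?big_cons //= IH.
Qed.

Let ext (u : 'I_m -> R) i := if insub i is Some j then u j else 0.

Lemma extE u (i : 'I_m) : ext u i = u i.
Proof. by rewrite /ext valK. Qed.

Lemma table_feasible u : feasible B g u ->
  (forall i, 0 <= ext u i) /\
  (forall k : 'I_3, \sum_(i < m) ext u i * (entry tb i k)%:~R = (k == 0)%:R).
Proof.
move=> [u0 ug]; split=> [i|k]; first by rewrite /ext; case: insubP.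
move/rowP/(_ k): ug; rewrite !mxE summxE => <-.
by apply: eq_bigr => i _; rewrite !mxE extE.
Qed.

Lemma table_nonface N : N \in Ns -> nonface B g d [set i : 'I_m | val i \in N].
Proof.
move=> NN u /table_feasible[u0 ug].
have /hasP[i iN ui] := allP (hit u0 ug) _ NN.
have im := allP (allP Ns_m _ NN) _ iN.
by exists (Ordinal im); rewrite ?inE // -extE.
Qed.

(** The coordinates above the margin meet every nonface and so contain a triple of [Ts], whose
    columns form a basis both for [A] over the integers and for [B] over the reals. *)
Lemma table_has u : feasible B g u ->
  exists x y z : 'I_m, [/\ d < u x, d < u y, d < u z &
    let D t := det3 (entry t x) (entry t y) (entry t z) in
    D ta * D ta = 1 /\ D tb != 0].
Proof.
move=> /table_feasible[u0 ug]; have /hitting/hasP[t tT tu] := hit u0 ug.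
have /and3P[/eqP + /eqP Da Db] := allP Ts_det _ tT.
have := allP Ts_m _ tT.
case: t tu {tT} Da Db => [|x [|y [|z [|//]]]] //= /and4P[ux uy uz _] Da Db.
move=> /and4P[xm ym zm _] _; exists (Ordinal xm), (Ordinal ym), (Ordinal zm).
by split=> //; rewrite -extE.
Qed.

Lemma table_spanB u : feasible B g u -> spans B [set i | d < u i].
Proof.
move=> /table_has[x [y [z [ux uy uz [_ D]]]]].
pose D' : R := (det3 (entry tb x) (entry tb y) (entry tb z))%:~R.
apply: (@spans_det3 _ _ _ x y z _ (D'^-1)); rewrite ?inE //.
by rewrite mulVf // intr_eq0.
Qed.

Lemma table_face (s : seq nat) (W : {set 'I_m}) : s \in Ss ->
  (forall i, i \in W -> zeros s (val i)) -> face B g W.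
Proof.
move=> sS sW; have /andP[] := allP Ss_sol _ sS.
rewrite /total (foldr_iota (fun i => nth 0 s i)) => s0 /= /and3P[].
rewrite !(foldr_iota (fun i => (nth 0 s i)%:Z * entry tb i _)) => /eqP e1 /eqP e2 _.
set t := (\sum_(i < m) nth 0 s i)%N in s0.
have t0 : 0 < t%:R :> R by rewrite ltr0n.
apply: (@face_sub _ _ _ _ _ (fun i : 'I_m => (nth 0%N s i)%:R / t%:R)).
- move=> u fu; apply: spansS (table_spanB fu); apply/fintype.subsetP => i.
  by rewrite !inE => /(lt_trans d0)/lt0r_neq0.
- split=> [i|]; first by rewrite divr_ge0.
  apply/rowP => k; rewrite summxE !mxE.
  under eq_bigr => i _ do rewrite !mxE mulrAC.
  rewrite -mulr_suml; apply: (canLR (mulfK _)); first by rewrite gt_eqF.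
  rewrite (eq_bigr (fun i : 'I_m => ((nth 0%N s i)%:Z * entry tb i k)%:~R)); last first.
    by move=> i _; rewrite rmorphM.
  rewrite -rmorph_sum; case: k => -[|[|[|//]]] ?; rewrite ?e1 ?e2 ?mul0r //=.
  rewrite mul1r /t natr_sum rmorph_sum /=; apply: eq_bigr => i _.
  rewrite (eqP (allP tb1 i _)) ?mulr1 // mem_iota.
  exact: ltn_ord.
- by move=> i /sW /eqP ->; rewrite mul0r.
Qed.

Lemma table_gale : gale B g A d.
Proof.
split=> // [i k||u /table_has[x [y [z [ux uy uz [D _]]]]]||i].
- by rewrite mxE intz.
- exists (\col_k (k == 0)%:R) => i; rewrite mxE big_ord_recl big1 ?addr0.
    by rewrite !mxE mulr1 (eqP (allP tb1 i _)) ?ltr01 // mem_iota ltn_ord.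
  by move=> k _; rewrite !mxE mulr0.
- apply: (@spans_det3 _ _ _ x y z); rewrite ?inE //.
  by rewrite intz; exact: D.
- exact: table_spanB.
have im : val i \in iota 0 m by rewrite mem_iota ltn_ord.
have /hasP[s sS si] := allP Ss_vert _ im.
by apply: (table_face sS) => j; rewrite inE => /eqP ->.
Qed.

Definition table_distinguished (i j : nat) := has (fun N => [&& i \in N, j \notin N &
  has (fun s => all (fun x => (x == i) || zeros s x) N) Ss]) Ns.

Lemma table_distinguishedP (i j : 'I_m) :
  table_distinguished i j -> distinguished B g d i j.
Proof.
move=> /hasP[N NN /and3P[iN jN /hasP[s sS sN]]].
exists [set x : 'I_m | val x \in N]; split; rewrite ?inE //.
  exact: table_nonface.
apply: (table_face sS) => x; rewrite !inE => /andP[xi xN].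
by have := allP sN _ xN; rewrite -(inj_eq val_inj) in xi; rewrite (negbTE xi).
Qed.

End Table.

(** A convex pentagon around the origin, lifted to height 1. Feasible points write the origin as a
    convex combination of its corners, and two neighbours cannot both have weight zero. *)
Definition pentagon_points : seq (seq int) := [:: [:: 1; 2; 0]; [:: 1; 1; 2];
  [:: 1; -2; 1]; [:: 1; -2; -1]; [:: 1; 1; -2]].
Definition pentagon_char : seq (seq int) := [:: [:: 1; 0; 0]; [:: 0; 1; 0];
  [:: 0; 1; 1]; [:: 0; 0; 1]; [:: 1; 0; 1]].
Definition pentagon_sols : seq (seq nat) := [:: [:: 0; 3; 4; 0; 5];
  [:: 2; 0; 1; 1; 0]; [:: 3; 2; 0; 4; 0]; [:: 3; 0; 4; 0; 2]]%N.
Definition pentagon_nonfaces : seq (seq nat) :=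
  [:: [:: 0; 1]; [:: 1; 2]; [:: 2; 3]; [:: 3; 4]; [:: 4; 0]]%N.
Definition pentagon_bases : seq (seq nat) :=
  [:: [:: 0; 1; 3]; [:: 0; 2; 3]; [:: 0; 2; 4]; [:: 1; 2; 4]; [:: 1; 3; 4]]%N.

(** A triangle around the origin with each corner taken twice; the two copies of a corner are
    opposite vertices of the octahedron. *)
Definition octahedron_points : seq (seq int) := [:: [:: 1; 1; 0]; [:: 1; 1; 0];
  [:: 1; 0; 1]; [:: 1; 0; 1]; [:: 1; -1; -1]; [:: 1; -1; -1]].
Definition octahedron_char : seq (seq int) := [:: [:: 1; 0; 0]; [:: 1; 0; 0];
  [:: 0; 1; 0]; [:: 0; 1; 0]; [:: 0; 0; 1]; [:: 0; 0; 1]].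
Definition octahedron_sols : seq (seq nat) := [:: [:: 1; 0; 1; 0; 1; 0];
  [:: 0; 1; 0; 1; 0; 1]]%N.
Definition octahedron_nonfaces : seq (seq nat) :=
  [:: [:: 0; 1]; [:: 2; 3]; [:: 4; 5]]%N.
Definition octahedron_bases : seq (seq nat) :=
  [:: [:: 0; 2; 4]; [:: 0; 2; 5]; [:: 0; 3; 4]; [:: 0; 3; 5];
      [:: 1; 2; 4]; [:: 1; 2; 5]; [:: 1; 3; 4]; [:: 1; 3; 5]]%N.

(* A Gale diagram of the cyclic polytope C_4(7). As C_4(7) carries no smooth
   projective fan, the unimodular vectors need a separate table. *)
Definition heptagon_points : seq (seq int) := [:: [:: 1; 3; 0]; [:: 1; 2; 2];
  [:: 1; -1; 3]; [:: 1; -3; 1]; [:: 1; -3; -1]; [:: 1; -1; -3]; [:: 1; 2; -2]].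
(** All seven nonzero vectors with entries 0 and 1, ordered so that every triple in [heptagon_bases]
    is unimodular. *)
Definition heptagon_char : seq (seq int) := [:: [:: 1; 0; 0]; [:: 0; 1; 0];
  [:: 0; 1; 1]; [:: 1; 1; 0]; [:: 0; 0; 1]; [:: 1; 0; 1]; [:: 1; 1; 1]].
Definition heptagon_sols : seq (seq nat) := [:: [:: 0; 0; 1; 1; 0; 0; 2];
  [:: 2; 0; 0; 1; 1; 0; 0]; [:: 0; 2; 0; 0; 1; 1; 0]; [:: 2; 0; 3; 0; 0; 3; 0]]%N.
Definition heptagon_nonfaces : seq (seq nat) := [:: [:: 0; 1; 2]; [:: 1; 2; 3];
  [:: 2; 3; 4]; [:: 3; 4; 5]; [:: 4; 5; 6]; [:: 5; 6; 0]; [:: 6; 0; 1]]%N.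
(** The triangles of corners that contain the origin; they are the complements of the 14 facets of
    [C_4(7)]. *)
Definition heptagon_bases : seq (seq nat) := [:: [:: 0; 1; 4]; [:: 0; 2; 4];
  [:: 0; 2; 5]; [:: 0; 3; 4]; [:: 0; 3; 5]; [:: 0; 3; 6]; [:: 1; 2; 5];
  [:: 1; 3; 5]; [:: 1; 3; 6]; [:: 1; 4; 5]; [:: 1; 4; 6]; [:: 2; 3; 6];
  [:: 2; 4; 6]; [:: 2; 5; 6]]%N.

Section Bases.
Variable R : realType.
Let g : 'rV[R]_3 := \row_k (k == 0)%:R.
Let d : R := 100%:R^-1.

Lemma ge0_table (t : seq (seq int)) : all (all (fun z => 0 <= z)) t ->
  forall i k, 0 <= entry t i k.
Proof.
move=> /allP t0 i k; rewrite /entry.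
have [it|it] := ltnP i (size t); last by rewrite (nth_default [::]) // nth_nil.
have [kt|kt] := ltnP k (size (nth [::] t i)); last by rewrite nth_default.
by apply: (allP (t0 _ (mem_nth _ it))); apply: mem_nth.
Qed.


(** Expands the three equations and refutes, for each nonface, that all its coordinates are at most
    [d]. Seven sign conditions suffice for every table. *)
Ltac hit_tac v v0 H :=
  have := conj (H (inord 0)) (conj (H (inord 1)) (H (inord 2)));
  rewrite !big_ord_recr !big_ord0 /= -!val_eqE /= !inordK //= /entry /= => ?;
  have := conj (v0 0%N) (conj (v0 1%N) (conj (v0 2%N) (conj (v0 3%N)
    (conj (v0 4%N) (conj (v0 5%N) (v0 6%N))))));
  rewrite /d => ?;
  repeat (apply/andP; split=> //); rewrite ?orbF; apply/negPn/negP;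
  rewrite !negb_or -!leNgt => ?; lra.

Lemma pentagon_hit (v : nat -> R) : (forall i, 0 <= v i) ->
  (forall k : 'I_3,
    \sum_(i < 5) v i * (entry pentagon_points i k)%:~R = (k == 0)%:R) ->
  all (has (fun i => d < v i)) pentagon_nonfaces.
Proof. by move=> v0 H; hit_tac v v0 H. Qed.

Lemma octahedron_hit (v : nat -> R) : (forall i, 0 <= v i) ->
  (forall k : 'I_3,
    \sum_(i < 6) v i * (entry octahedron_points i k)%:~R = (k == 0)%:R) ->
  all (has (fun i => d < v i)) octahedron_nonfaces.
Proof. by move=> v0 H; hit_tac v v0 H. Qed.

Lemma heptagon_hit (v : nat -> R) : (forall i, 0 <= v i) ->
  (forall k : 'I_3,
    \sum_(i < 7) v i * (entry heptagon_points i k)%:~R = (k == 0)%:R) ->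
  all (has (fun i => d < v i)) heptagon_nonfaces.
Proof. by move=> v0 H; hit_tac v v0 H. Qed.

Lemma d_gt0 : 0 < d. Proof. by rewrite invr_gt0 ltr0n. Qed.

Lemma pentagon_gale : gale (table_rows R pentagon_points : 'I_5 -> _) g
  (table_rows int pentagon_char) d.
Proof.
apply: (table_gale d_gt0 (ge0_table _) _ pentagon_hit
  (Ts := pentagon_bases) (Ss := pentagon_sols)); try by vm_compute.
by move=> b /=; do 5?case: (b _).
Qed.

Lemma octahedron_gale : gale (table_rows R octahedron_points : 'I_6 -> _) g
  (table_rows int octahedron_char) d.
Proof.
apply: (table_gale d_gt0 (ge0_table _) _ octahedron_hit
  (Ts := octahedron_bases) (Ss := octahedron_sols)); try by vm_compute.
by move=> b /=; do 6?case: (b _).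
Qed.

Lemma heptagon_gale : gale (table_rows R heptagon_points : 'I_7 -> _) g
  (table_rows int heptagon_char) d.
Proof.
apply: (table_gale d_gt0 (ge0_table _) _ heptagon_hit
  (Ts := heptagon_bases) (Ss := heptagon_sols)); try by vm_compute.
by move=> b /=; do 7?case: (b _).
Qed.


Lemma all_pairs m (P : rel nat) :
  all (fun i => all (P i) (iota 0 m)) (iota 0 m) -> forall i j : 'I_m, P i j.
Proof.
move=> /allP H i j; have iota_m (k : 'I_m) : val k \in iota 0 m.
  by rewrite mem_iota ltn_ord.
exact: (allP (H _ (iota_m i)) _ (iota_m j)).
Qed.

Lemma seed_gale_pentagon : seed_gale R 3 5.
Proof.
exists 'I_5, (table_rows R pentagon_points), g, (table_rows int pentagon_char), d.
split=> [||i j ij|]; [exact: card_ord|exact: pentagon_gale| |].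
  have := @all_pairs 5 (fun i j : nat => (i != j) ==>
      table_distinguished pentagon_nonfaces pentagon_sols i j) ltac:(by vm_compute) i j.
  rewrite /= val_eqE ij /= => H; left.
  apply: (table_distinguishedP d_gt0 _ pentagon_hit (ta := pentagon_char)
    (Ts := pentagon_bases) (Ss := pentagon_sols)) H; try by vm_compute.
  by move=> b /=; do 5?case: (b _).
exists (inord 1), (inord 4); split; first by rewrite -val_eqE /= !inordK.
apply: (table_face d_gt0 _ pentagon_hit (ta := pentagon_char)
  (Ts := pentagon_bases) (Ss := pentagon_sols) _ _ _ _
  (s := [:: 2; 0; 1; 1; 0]%N)); try by vm_compute.
  by move=> b /=; do 5?case: (b _).
by move=> i; rewrite !inE => /orP[] /eqP ->; rewrite /= inordK.
Qed.

Lemma seed_gale_heptagon : seed_gale R 3 7.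
Proof.
exists 'I_7, (table_rows R heptagon_points), g, (table_rows int heptagon_char), d.
split=> [||i j ij|]; [exact: card_ord|exact: heptagon_gale| |].
  have := @all_pairs 7 (fun i j : nat => (i != j) ==>
      table_distinguished heptagon_nonfaces heptagon_sols i j) ltac:(by vm_compute) i j.
  rewrite /= val_eqE ij /= => H; left.
  apply: (table_distinguishedP d_gt0 _ heptagon_hit (ta := heptagon_char)
    (Ts := heptagon_bases) (Ss := heptagon_sols)) H; try by vm_compute.
  by move=> b /=; do 7?case: (b _).
exists (inord 1), (inord 2); split; first by rewrite -val_eqE /= !inordK.
apply: (table_face d_gt0 _ heptagon_hit (ta := heptagon_char)
  (Ts := heptagon_bases) (Ss := heptagon_sols) _ _ _ _
  (s := [:: 2; 0; 0; 1; 1; 0; 0]%N)); try by vm_compute.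
  by move=> b /=; do 7?case: (b _).
by move=> i; rewrite !inE => /orP[] /eqP ->; rewrite /= inordK.
Qed.

(* Compared with [seed_gale], two vertices that do not span an edge need not be
   distinguished: a wedge always contains the edge [v v']. *)
Definition weak_seed_gale p m := exists (B : 'I_m -> 'rV[R]_p)
    (g : 'rV[R]_p) (A : 'I_m -> 'rV[int]_p) (d : R),
  gale B g A d /\ forall i j, i != j ->
    [\/ distinguished B g d i j, distinguished B g d j i |
        nonface B g d [set i; j]].

Lemma weak_seed_gale_octahedron : weak_seed_gale 3 6.
Proof.
exists (table_rows R octahedron_points), g, (table_rows int octahedron_char), d.
split=> [|i j ij]; first exact: octahedron_gale.
(* Equal halves characterize the opposite vertices [2k] and [2k + 1]. *)
have := @all_pairs 6 (fun i j : nat => (i != j) ==>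
    table_distinguished octahedron_nonfaces octahedron_sols i j ||
    (minn i j %/ 2 == maxn i j %/ 2)%N) ltac:(by vm_compute) i j.
rewrite /= val_eqE ij /= => /orP[H|H].
  apply: Or31; apply: (table_distinguishedP d_gt0 _ octahedron_hit (ta := octahedron_char)
    (Ts := octahedron_bases) (Ss := octahedron_sols)) H; try by vm_compute.
  by move=> b /=; do 6?case: (b _).
apply: Or33.
have := @all_pairs 6 (fun i j : nat => (i != j) ==> (minn i j %/ 2 == maxn i j %/ 2)%N ==>
    (([:: minn i j; maxn i j] \in octahedron_nonfaces))) ltac:(by vm_compute) i j.
rewrite /= val_eqE ij H /= => N.
have := table_nonface octahedron_hit _ N; rewrite (_ : [set _ | _] = [set i; j]).
  by apply; vm_compute.
apply/setP => x; rewrite !inE -!(inj_eq val_inj) /=.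
by case: (leqP i j) => _ //; rewrite orbC.
Qed.

Lemma seed_gale_weak p m : seed_gale R p m -> weak_seed_gale p m.
Proof.
move=> [I [B [g' [A [d' [Im G sep _]]]]]].
pose pi (k : 'I_m) : I := enum_val (cast_ord (esym Im) k).
have pi_inj : injective pi by move=> k l /enum_val_inj/cast_ord_inj.
have surj i : exists k, pi k = i.
  exists (cast_ord Im (enum_rank i)).
  by rewrite /pi cast_ordK enum_rankK.
exists (B \o pi), g', (A \o pi), (d' / #|'I_m|.+1%:R).
split=> [|i j ij]; first exact: gale_pull.
have /sep[H|H] : pi i != pi j by rewrite (inj_eq pi_inj).
  by apply: Or31; apply: distinguished_pull G _ _ _ H.
by apply: Or32; apply: distinguished_pull G _ _ _ H.
Qed.

Lemma seed_gale_ge4 p m : (4 <= p)%N -> (p + 2 <= m <= 2 ^ p - 1)%N ->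
  seed_gale R p m.
Proof.
elim: p m => // p IH m; rewrite leq_eqVlt => /predU1P[<-|p4] /andP[m1 m2].
  have [m7|m7] := leqP m 11.
    rewrite (_ : m = (5 + (m - 6)).+1); last lia.
    by apply: seed_gale_step seed_gale_pentagon; lia.
  rewrite (_ : m = (7 + (m - 8)).+1); last lia.
  by apply: seed_gale_step seed_gale_heptagon; lia.
rewrite expnS in m2.
have := leqP m (2 ^ p); have p2 : (p.+3 < 2 ^ p)%N.
  elim: p p4 {IH m1 m2} => // p IHp; rewrite leq_eqVlt => /predU1P[[<-]//|/IHp].
  by move=> H; rewrite expnS; lia.
move=> [mp|mp].
  rewrite (_ : m = (m.-1 + 0).+1); last lia.
  by apply: seed_gale_step => //; apply: IH => //; lia.
rewrite (_ : m = ((2 ^ p).-1 + (m - 2 ^ p)).+1); last lia.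
by apply: seed_gale_step; [lia|apply: IH => //; lia].
Qed.

Lemma weak_seed_gale_exists p m : (3 <= p)%N -> (p + 2 <= m <= 2 ^ p - 1)%N ->
  weak_seed_gale p m.
Proof.
rewrite leq_eqVlt => /predU1P[<-|p4] mp; last exact/seed_gale_weak/seed_gale_ge4.
have {mp} : m \in [:: 5; 6; 7]%N by rewrite !inE; lia.
rewrite !inE => /or3P[] /eqP ->.
- exact/seed_gale_weak/seed_gale_pentagon.
- exact: weak_seed_gale_octahedron.
- exact/seed_gale_weak/seed_gale_heptagon.
Qed.

End Bases.

(** * Complete simplicial fans *)

Section Fans.
Variable R : realType.

Definition supp (V : finType) (a : {ffun V -> R}) := [set v | a v != 0].

(** Coefficient vectors without normalization: the cone over the geometric realization of [K]. *)
Definition cone (V : finType) (K : {set {set V}}) (a : {ffun V -> R}) :=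
  (forall v, 0 <= a v) /\ supp a \in K.

Definition down_closed (V : finType) (K : {set {set V}}) :=
  forall s t : {set V}, t \subset s -> s \in K -> t \in K.

(** A complete simplicial fan. Uniqueness of coordinates says that the cones are simplicial and meet
    in common faces; existence says that they cover the space. *)
Record fan (n : nat) (V : finType) (K : {set {set V}}) (x : V -> 'rV[R]_n) :
    Prop := Fan {
  fan_down : down_closed K;
  fan_inj : forall a b, cone K a -> cone K b ->
    \sum_v a v *: x v = \sum_v b v *: x v -> a = b;
  fan_surj : forall y, exists2 a, cone K a & \sum_v a v *: x v = y }.

Lemma cone0 (V : finType) (K : {set {set V}}) : finset.set0 \in K ->
  cone K [ffun=> 0].
Proof.
move=> K0; split=> [v|]; first by rewrite ffunE.
by rewrite (_ : supp _ = finset.set0) //; apply/setP => v; rewrite !inE ffunE eqxx.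
Qed.

Section FanTheory.
Variables (n : nat) (V : finType) (K : {set {set V}}) (x : V -> 'rV[R]_n).
Hypothesis F : fan K x.

Lemma fan_set0 : finset.set0 \in K.
Proof.
have [a [_ aK] _] := fan_surj F 0.
by apply: fan_down F _ _ _ aK; apply: finset.sub0set.
Qed.

(* Positive and negative parts of a relation among the generators of a cone are
   two points of the cone with the same image. *)
Lemma fan_free (s : {set V}) (c : V -> R) : s \in K ->
  \sum_(v in s) c v *: x v = 0 -> forall v, v \in s -> c v = 0.
Proof.
move=> sK c0 v vs.
pose pos (f : V -> R) : {ffun V -> R} :=
  [ffun v => if v \in s then Num.max 0 (f v) else 0].
have posK f : cone K (pos f).
  split=> [w|]; first by rewrite ffunE; case: ifP => // _; rewrite le_max lexx.
  apply: fan_down F _ _ _ sK; apply/fintype.subsetP => w; rewrite inE ffunE.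
  by case: ifP => //; rewrite eqxx.
have E w : w \in s -> pos c w - pos (\- c) w = c w.
  move=> ws; rewrite !ffunE ws /=.
  by have [c1|c1] := leP 0 (c w); have [c2|c2] := leP 0 (- c w); lra.
suff e : pos c = pos (\- c) by rewrite -E // e subrr.
apply: (fan_inj F) => //; apply/eqP; rewrite -subr_eq0 -sumrB; apply/eqP; rewrite -[RHS]c0.
rewrite [RHS]big_mkcond; apply: eq_bigr => w _; rewrite -scalerBl.
by case: ifPn => [/E ->//|ws]; rewrite !ffunE (negbTE ws) subrr scale0r.
Qed.

(** A maximal cone has full dimension. Points of the ray arbitrarily close to its origin lie in a
    single cone [t]; as cones are closed, so does the origin. Uniqueness of coordinates gives [s]
    inside [t], maximality gives [t = s], and [y] is a combination of the generators of [t]. *)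
Lemma fan_facet_full (s : {set V}) (y : 'rV[R]_n) : facet K s ->
  exists c : V -> R, y = \sum_(v in s) c v *: x v.
Proof.
move=> [sK smax]; pose one : {ffun V -> R} := [ffun v => (v \in s)%:R].
have oneE : \sum_v one v *: x v = \sum_(v in s) x v.
  rewrite [RHS]big_mkcond; apply: eq_bigr => v _; rewrite ffunE.
  by case: (v \in s); rewrite ?scale1r ?scale0r.
pose Q (t : {set V}) (e : R) := forall r a, 0 < r -> r <= e -> cone K a -> supp a = t ->
  \sum_v a v *: x v <> \sum_(v in s) x v + r *: y.
(* Some cone meets the ray from the barycenter of [s] in direction [y]
   arbitrarily close to the origin of that ray. *)
have [t nQ] : exists t, forall e, 0 < e -> ~ Q t e.
  apply: contrapT => H; have [e e0 eQ] : exists2 e, 0 < e & forall t, Q t e.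
    apply: uniform_pos => [t a b _ ba Qa r f r0 rb|t].
      by apply: Qa => //; apply: le_trans ba.
    apply: contrapT => nQ; apply: H; exists t => e e0 Qe; apply: nQ.
    by exists e.
  have [a aK ay] := fan_surj F (\sum_(v in s) x v + e *: y).
  exact: (eQ (supp a) e a) ay.
have get e : 0 < e -> exists r a, [/\ 0 < r, r <= e, cone K a, supp a = t &
    \sum_v a v *: x v = \sum_(v in s) x v + r *: y].
  move=> e0; apply: contrapT => H; apply: (nQ e e0) => r a r0 re aK at_ ay.
  by apply: H; exists r, a.
have [r1 [a1 [r10 _ a1K a1t a1y]]] := get 1 ltr01.
have [|r2 [a2 [r20 r2r a2K a2t a2y]]] := get (r1 / 2); first by rewrite divr_gt0.
have r12 : r2 < r1 by apply: le_lt_trans r2r _; rewrite ltr_pdivrMr // ltr_pMr // ltr1n.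
have tK : t \in K by rewrite -a1t; case: a1K.
(* [al + r *: be] are the coordinates of the points of the ray in this cone *)
pose be v := (a1 v - a2 v) / (r1 - r2); pose al v := a1 v - r1 * be v.
have r120 : r1 - r2 != 0 by rewrite subr_eq0 gt_eqF.
have beE : \sum_v be v *: x v = y.
  rewrite /be; under eq_bigr => v _ do rewrite mulrC -scalerA scalerBl.
  rewrite -scaler_sumr sumrB a1y a2y opprD addrACA subrr add0r -scalerBl scalerA.
  by rewrite mulVf // scale1r.
have alE : \sum_v al v *: x v = \sum_(v in s) x v.
  rewrite /al; under eq_bigr => v _ do rewrite scalerBl -scalerA.
  by rewrite sumrB -scaler_sumr beE a1y addrK.
have a0 (a : {ffun V -> R}) v : supp a = t -> v \notin t -> a v = 0.
  by move=> <-; rewrite inE negbK => /eqP.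
have be0 v : v \notin t -> be v = 0 by move=> vt; rewrite /be !a0 // subrr mul0r.
have al0 v : v \notin t -> al v = 0.
  by move=> vt; rewrite /al be0 // a0 // mulr0 subrr.
have ray r a : cone K a -> supp a = t ->
    \sum_v a v *: x v = \sum_(v in s) x v + r *: y -> forall v, a v = al v + r * be v.
  move=> aK at_ ay v; have [vt|vt] := boolP (v \in t); last first.
    by rewrite al0 // be0 // a0 // mulr0 addr0.
  apply/eqP; rewrite -subr_eq0; apply/eqP.
  apply: (fan_free (c := fun v => a v - (al v + r * be v)) tK) vt.
  rewrite -[RHS](subrr (\sum_v a v *: x v)) {2}ay -alE -beE scaler_sumr -big_split.
  rewrite -sumrB [LHS]big_mkcond; apply: eq_bigr => w _ /=.
  case: ifPn => wt; first by rewrite scalerBl scalerDl scalerA.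
  by rewrite al0 // be0 // a0 // !scale0r scaler0 addr0 subrr.
(* Closedness of the cone: a negative [al v] would make the coordinate negative at nearby points of
   the ray too. *)
have al_ge0 v : 0 <= al v.
  rewrite leNgt; apply/negP => alv.
  have [|r [a [r0 re aK at_ ay]]] := get (- al v / (1 + `|be v|)).
    by rewrite divr_gt0 ?oppr_gt0 // ltr_pwDl.
  have [av _] := aK; have := av v; rewrite (ray _ _ aK at_ ay).
  apply/negP; rewrite -ltNge.
  have := re; rewrite ler_pdivlMr ?ltr_pwDl // mulrDr mulr1.
  have : r * be v <= r * `|be v| by rewrite ler_pM2l // ler_norm.
  by lra.
have alK : cone K [ffun v => al v].
  split=> [v|]; first by rewrite ffunE.
  apply: fan_down F _ _ _ tK; apply/fintype.subsetP => v; rewrite inE ffunE.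
  by apply: contraR => /al0 ->.
have one_al : one = [ffun v => al v].
  apply: (fan_inj F) => //.
    split=> [v|]; first by rewrite ffunE ler0n.
    rewrite (_ : supp _ = s) //; apply/setP => v; rewrite inE ffunE.
    by case: (v \in s); rewrite ?oner_eq0 ?eqxx.
  by rewrite oneE -alE; apply: eq_bigr => v _; rewrite ffunE.
have ts : t = s.
  apply: smax => //; apply/fintype.subsetP => v vs; apply: contraLR vs => /al0 H.
  move/ffunP/(_ v): one_al; rewrite !ffunE H.
  by case: (v \in s) => // /eqP; rewrite oner_eq0.
exists be; rewrite -beE [RHS]big_mkcond; apply: eq_bigr => v _.
by case: ifPn => //; rewrite -ts => /be0 ->; rewrite scale0r.
Qed.

Lemma fan_pure (s : {set V}) : facet K s -> #|s| = n.
Proof.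
move=> sF; pose M : 'M[R]_(#|s|, n) := \matrix_(i, j) x (enum_val i) 0 j.
have ME (c : V -> R) : (\row_i c (enum_val i)) *m M = \sum_(v in s) c v *: x v.
  apply/rowP => j; rewrite mxE summxE [RHS]big_enum_val.
  by apply: eq_bigr => i _; rewrite !mxE.
have free : row_free M.
  rewrite -kermx_eq0; apply/rowV0P => u /sub_kermxP uM.
  pose c w := \sum_i (enum_val i == w)%:R * u 0 i.
  have cE i : c (enum_val i) = u 0 i.
    rewrite /c (bigD1 i) //= eqxx mul1r big1 ?addr0 // => j ji.
    by rewrite (inj_eq enum_val_inj) (negbTE ji) mul0r.
  apply/rowP => i; rewrite mxE -cE; apply: (fan_free (s := s)).
  - by case: sF.
  - by rewrite -ME -[RHS]uM; congr (_ *m _); apply/rowP => j; rewrite mxE cE.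
  - exact: enum_valP.
have full : row_full M.
  rewrite -sub1mx; apply/row_subP => i.
  by have [c ->] := fan_facet_full (row i 1%:M) sF; rewrite -ME submxMl.
by move: free full; rewrite /row_free /row_full => /eqP -> /eqP.
Qed.

Lemma fan_complex : (forall v, [set v] \in K) -> simplicial_complex K.
Proof.
move=> K1; split=> //; first exact: fan_set0.
  exact: fan_down F.
by move=> s t /fan_pure -> /fan_pure ->.
Qed.

Lemma fan_facet_exists : exists2 s, facet K s & forall t, t \in K -> (#|t| <= #|s|)%N.
Proof.
have [s sK smax] := arg_maxnP (fun s : {set V} => #|s|) fan_set0.
exists s => //; split=> // t tK st; apply/esym/eqP; rewrite eqEcard st.
exact: smax.
Qed.

End FanTheory.

(** * The fan of a simplex *)

Section SimplexFan.
Variable n : nat.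

Definition simplex_rays (i : 'I_n.+1) : 'rV[R]_n :=
  if unlift ord0 i is Some k then delta_mx 0 k else const_mx (-1).

Lemma simplex_raysE (a : 'I_n.+1 -> R) k :
  (\sum_i a i *: simplex_rays i) 0 k = a (lift ord0 k) - a ord0.
Proof.
rewrite summxE big_ord_recl /simplex_rays unlift_none !mxE mulrN1 addrC.
congr (_ - _); rewrite (bigD1 k) //= liftK !mxE !eqxx mulr1 big1 ?addr0 //.
by move=> j jk; rewrite liftK !mxE eq_sym (negbTE jk) mulr0.
Qed.

(** The relations among the rays are the constant vectors, so subtracting the minimum gives the
    unique nonnegative coordinates with a zero entry. *)
Lemma simplex_fan : fan (simplex_bd [set: 'I_n.+1]) simplex_rays.
Proof.
have bdE (a : {ffun 'I_n.+1 -> R}) :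
    supp a \in simplex_bd [set: 'I_n.+1] <-> exists i, a i = 0.
  rewrite inE; split=> [/fintype.properP[_ [i _]]|[i ai]].
    by rewrite inE negbK => /eqP; exists i.
  apply/fintype.properP; split; first exact: finset.subsetT.
  by exists i; rewrite ?inE // ai eqxx.
split.
- by move=> s t ts; rewrite !inE; apply: sub_proper_trans.
- move=> a b [a0 /bdE[i ai]] [b0 /bdE[j bj]] ab.
  have E k : a k - a ord0 = b k - b ord0.
    case: (unliftP ord0 k) => [l ->|->]; last by rewrite !subrr.
    by rewrite -!simplex_raysE ab.
  apply/ffunP => k; have := E i; have := E j; have := E k.
  have := a0 j; have := b0 i; rewrite ai bj; lra.
- move=> y; pose f i := if unlift ord0 i is Some k then y 0 k else 0.
  have [i _ imin] := @Order.TotalTheory.arg_minP _ _ _ ord0 xpredT f isT.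
  exists [ffun j => f j - f i].
    split=> [j|]; first by rewrite ffunE subr_ge0 imin.
    by apply/bdE; exists i; rewrite ffunE subrr.
  apply/rowP => k; rewrite simplex_raysE !ffunE opprB addrA subrK.
  by rewrite /f liftK unlift_none subr0.
Qed.

End SimplexFan.

End Fans.

(** * Common refinements and PL spheres *)

(* [y] maps the generators of the fan [K'] into the cones of [K], linearly and
   bijectively on the whole. *)
Record refines (R : realType) (W V : finType) (K' : {set {set W}})
    (K : {set {set V}}) (y : W -> {ffun V -> R}) : Prop := Refines {
  refines_ge0 : forall w v, 0 <= y w v;
  refines_neq0 : forall w, exists v, y w v != 0;
  refines_sub : forall c, c \in K' ->
    exists2 t, t \in K & forall w v, w \in c -> y w v != 0 -> v \in t;
  refines_surj : forall a, cone K a ->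
    exists2 b, cone K' b & linear_extension y b = a;
  refines_inj : forall b b', cone K' b -> cone K' b' ->
    linear_extension y b = linear_extension y b' -> b = b' }.

Section Refines.
Variables (R : realType) (W V : finType) (K' : {set {set W}}) (K : {set {set V}}).
Variable y : W -> {ffun V -> R}.
Hypothesis ref : refines K' K y.
Hypothesis Kdown : down_closed K.

Lemma refines_cone b : cone K' b -> cone K (linear_extension y b).
Proof.
move=> [b0 bK]; have [t tK H] := refines_sub ref bK; split=> [v|].
  by rewrite ffunE sumr_ge0 // => w _; rewrite mulr_ge0 ?(refines_ge0 ref).
apply: Kdown tK; apply/fintype.subsetP => v; rewrite inE ffunE => vb.
apply: contraNT vb => vt; apply/eqP; rewrite big1 // => w _.
have [->|bw] := eqVneq (b w) 0; first by rewrite mul0r.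
have [->|yw] := eqVneq (y w v) 0; first by rewrite mulr0.
by rewrite (H w v) ?inE in vt.
Qed.

(** Supplies the purity of the refinement, which is again a complete fan. *)
Lemma refines_fan n (x : V -> 'rV[R]_n) : down_closed K' -> fan K x ->
  fan K' (fun w => \sum_v y w v *: x v).
Proof.
move=> K'down F.
have E (b : {ffun W -> R}) :
    \sum_w b w *: \sum_v y w v *: x v = \sum_v linear_extension y b v *: x v.
  under eq_bigr => w _ do rewrite scaler_sumr.
  rewrite exchange_big; apply: eq_bigr => v _; rewrite ffunE scaler_suml.
  by apply: eq_bigr => w _; rewrite scalerA.
split=> // [b b' bc b'c|p].
  rewrite !E => /(fan_inj F (refines_cone bc) (refines_cone b'c)).
  by apply: refines_inj ref _ _ _ _.
have [a /(refines_surj ref)[b bc <-] <-] := fan_surj F p.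
by exists b.
Qed.

Let mass w := \sum_v y w v.

Lemma mass_gt0 w : 0 < mass w.
Proof.
have [v yv] := refines_neq0 ref w; rewrite /mass (bigD1 v) //= ltr_pwDl //.
  by rewrite lt_def yv (refines_ge0 ref).
by apply: sumr_ge0 => u _; exact: refines_ge0 ref _ _.
Qed.

(** Dividing each generator by its mass moves it into the realization; multiplying the coefficients
    by the masses turns cone coordinates into convex weights. *)
Lemma refines_subdivision : simplicial_complex K' -> subdivision R K' K.
Proof.
move=> K'c; split=> //; pose f w : {ffun V -> R} := [ffun v => y w v / mass w].
have mass0 w : mass w != 0 by rewrite gt_eqF ?mass_gt0.
have f0 w v : (f w v != 0) = (y w v != 0).
  by rewrite ffunE mulf_eq0 invr_eq0 (negbTE (mass0 w)) orbF.
have fE (a b : {ffun W -> R}) : (forall w, a w = b w * mass w) ->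
    linear_extension f a = linear_extension y b.
  move=> ab; apply/ffunP => v; rewrite !ffunE; apply: eq_bigr => w _.
  by rewrite ffunE ab -mulrA; congr (_ * _); rewrite mulrC divfK.
have supE (a b : {ffun W -> R}) : (forall w, a w = b w * mass w) -> supp a = supp b.
  move=> ab; apply/setP => w; rewrite !inE ab mulf_eq0 (negbTE (mass0 w)).
  by rewrite orbF.
have down (a : {ffun W -> R}) : exists b : {ffun W -> R}, forall w, a w = b w * mass w.
  by exists [ffun w => a w / mass w] => w; rewrite ffunE divfK.
have coneE (a b : {ffun W -> R}) : (forall w, a w = b w * mass w) ->
    realization R K' a -> cone K' b.
  move=> ab [[a0 _] aK]; split; last by rewrite -(supE a b ab).
  by move=> w; have := a0 w; rewrite ab pmulr_lge0 ?mass_gt0.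
have sumE (a b : {ffun W -> R}) : (forall w, a w = b w * mass w) ->
    \sum_v linear_extension y b v = \sum_w a w.
  move=> ab; under eq_bigr => v _ do rewrite ffunE.
  by rewrite exchange_big; apply: eq_bigr => w _; rewrite ab -mulr_sumr.
exists f; split=> [s sK|].
  have [t tK H] := refines_sub ref sK; exists t => // w v ws.
  by rewrite f0; apply: H.
split=> [a|a a'|c [[c0 c1] cK]].
- move=> ra; have [b ab] := down a; rewrite (fE a b ab).
  have bc := coneE a b ab ra; have [l0 lK] := refines_cone bc.
  by case: ra => -[_ a1] _; split=> //; split=> //; rewrite (sumE a b ab).
- rewrite !inE => ra ra'; have [b ab] := down a; have [b' ab'] := down a'.
  rewrite (fE a b ab) (fE a' b' ab').
  move=> /(refines_inj ref (coneE a b ab ra) (coneE a' b' ab' ra')) bb.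
  by apply/ffunP => w; rewrite ab ab' bb.
have [b bc bE] := refines_surj ref (conj c0 cK : cone K c).
pose a : {ffun W -> R} := [ffun w => b w * mass w].
have ab w : a w = b w * mass w by rewrite ffunE.
exists a; last by rewrite (fE a b ab).
case: (bc) => b0 bK; split; last by rewrite -[[set _ | _]]/(supp a) (supE a b ab).
split=> [w|]; first by rewrite ab mulr_ge0 // ltW ?mass_gt0.
by rewrite -(sumE a b ab) bE.
Qed.

End Refines.

(** * Cutting a cell structure into flags *)

Section Barycentric.
Variable R : realType.
Variables (U : finType) (X : {ffun U -> R} -> Prop).
Hypothesis X0 : X [ffun=> 0].
Hypothesis X_ge0 : forall q, X q -> forall j, 0 <= q j.
(** This stands in for polyhedrality of the cells. [t] may be negative, so a point can be subtracted
    until some coordinate vanishes. *)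
Hypothesis X_add : forall q q' t, X q -> X q' -> supp q' \subset supp q ->
  (forall j, 0 <= q j + t * q' j) -> X [ffun j => q j + t * q' j].

Definition cell_pred (w : {set U}) : bool :=
  (w != finset.set0) && `[< exists2 q, X q & supp q = w >].
Definition cell := {w : {set U} | cell_pred w}.

(** The order complex of the cells, that is, the barycentric subdivision; [y] below picks a point in
    the relative interior of each cell. *)
Definition flags : {set {set cell}} := [set c : {set cell} |
  [forall w in c, forall w' in c, (val w \subset val w') || (val w' \subset val w)]].

Lemma flags_down : down_closed flags.
Proof.
move=> c b /fintype.subsetP bc; rewrite !inE => /forall_inP H.
by apply/forall_inP => w /bc/H/forall_inP Hw; apply/forall_inP => w' /bc/Hw.
Qed.

Lemma flags1 (w : cell) : [set w] \in flags.
Proof.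
rewrite inE; apply/forall_inP => a; rewrite inE => /eqP ->.
by apply/forall_inP => b; rewrite inE => /eqP ->; rewrite fintype.subxx.
Qed.

Lemma flags_top (c : {set cell}) w0 : c \in flags -> w0 \in c ->
  exists2 w, w \in c & forall w', w' \in c -> val w' \subset val w.
Proof.
rewrite inE => /forall_inP H w0c.
have [w wc wmax] := arg_maxnP (fun w : cell => #|val w|) w0c.
exists w => // w' wc'; have /forall_inP/(_ _ wc')/orP[|//] := H _ wc.
move=> ww'; have /eqP -> : val w == val w' by rewrite eqEcard ww'; exact: wmax.
exact: fintype.subxx.
Qed.

Variable y : cell -> {ffun U -> R}.
Hypothesis yX : forall w, X (y w).
Hypothesis y_supp : forall w, supp (y w) = val w.

Let lin (b : {ffun cell -> R}) j := \sum_w b w * y w j.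

Lemma cell_supp q : X q -> supp q != finset.set0 -> exists w : cell, val w = supp q.
Proof.
move=> qX q0; have qW : cell_pred (supp q) by rewrite /cell_pred q0; apply/asboolP; exists q.
by exists (Sub _ qW).
Qed.

Lemma cell_gt0 (w : cell) j : j \in val w -> 0 < y w j.
Proof.
by rewrite -y_supp inE => yj; rewrite lt_def yj (X_ge0 (yX w)).
Qed.

Lemma cell_eq0 (w : cell) j : j \notin val w -> y w j = 0.
Proof. by rewrite -y_supp inE negbK => /eqP. Qed.

Lemma lin_neq0 (b : {ffun cell -> R}) j : (forall w, 0 <= b w) ->
  (lin b j != 0) = [exists w in supp b, j \in val w].
Proof.
move=> b0; rewrite /lin psumr_neq0 => [|w _]; last by rewrite mulr_ge0 ?(X_ge0 (yX w)).
apply/hasP/exists_inP => [[w _ /=]|[w wb jw]].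
  move=> H; exists w; rewrite ?inE; first by apply: contraTneq H => ->; rewrite mul0r ltxx.
  by apply: contraTT H => /cell_eq0 ->; rewrite mulr0 ltxx.
exists w; rewrite ?mem_index_enum //= mulr_gt0 ?cell_gt0 //.
by rewrite lt_def b0 andbT; rewrite inE in wb.
Qed.

(** Nonnegative terms do not cancel, so the leading cell of a combination can be read off its
    value. *)
Lemma lin_top b w : cone flags b -> w \in supp b ->
  (forall w', w' \in supp b -> val w' \subset val w) ->
  forall j, (lin b j != 0) = (j \in val w).
Proof.
move=> [b0 _] wb wmax j; rewrite lin_neq0 //; apply/exists_inP/idP => [[w' /wmax]|jw].
  by move=> /fintype.subsetP; apply.
by exists w.
Qed.

(** Starting from the leading term, the others are added one by one; their supports lie inside the
    leading one, as [X_add] demands. *)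
Lemma lin_in_X b : cone flags b -> X [ffun j => lin b j].
Proof.
move=> bc; have [b0 bK] := bc.
have [e|/set0Pn[w0 w0b]] := eqVneq (supp b) finset.set0.
  rewrite (_ : [ffun _ => _] = [ffun=> 0]) //; apply/ffunP => j; rewrite !ffunE.
  rewrite /lin big1 // => w _; move/setP/(_ w): e.
  by rewrite !inE => /negbFE/eqP ->; rewrite mul0r.
have [w wb wtop] := flags_top bK w0b.
have bw : 0 < b w by rewrite lt_def b0 andbT; rewrite inE in wb.
suff H (r : seq cell) :
    X [ffun j => b w * y w j + \sum_(v <- r | v != w) b v * y v j].
  rewrite (_ : [ffun _ => _] = [ffun j => b w * y w j +
    \sum_(v <- index_enum cell | v != w) b v * y v j]) //.
  by apply/ffunP => j; rewrite !ffunE /lin (bigD1 w).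
elim: r => [|v r IH].
  rewrite (_ : [ffun _ => _] = [ffun j => y w j + (b w - 1) * y w j]).
    apply: X_add => // j.
    by rewrite mulrBl mul1r addrC subrK mulr_ge0 // X_ge0.
  by apply/ffunP => j; rewrite !ffunE big_nil addr0 mulrBl mul1r [RHS]addrC subrK.
have [vw|vw] := boolP (v != w); last first.
  rewrite (_ : [ffun _ => _] = [ffun j => b w * y w j +
    \sum_(v <- r | v != w) b v * y v j]) //.
  by apply/ffunP => j; rewrite !ffunE big_cons (negbTE vw).
have [bv|bv] := eqVneq (b v) 0.
  rewrite (_ : [ffun _ => _] = [ffun j => b w * y w j +
    \sum_(v <- r | v != w) b v * y v j]) //.
  by apply/ffunP => j; rewrite !ffunE big_cons vw bv mul0r add0r.
set q := [ffun _ => _] in IH; rewrite (_ : [ffun _ => _] = [ffun j => q j + b v * y v j]).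
  apply: X_add => // [|j]; last by rewrite addr_ge0 ?X_ge0 // mulr_ge0 // X_ge0.
  rewrite y_supp; apply: fintype.subset_trans (wtop v _) _; first by rewrite inE.
  apply/fintype.subsetP => j jw; rewrite inE ffunE gt_eqF // ltr_wpDr //.
    by apply: sumr_ge0 => u _; rewrite mulr_ge0 // X_ge0.
  by rewrite mulr_gt0 // cell_gt0.
by apply/ffunP => j; rewrite !ffunE big_cons vw addrCA addrC.
Qed.

(* Remove from [q] the largest possible multiple of the chosen point of its
   cell. *)
Lemma flags_surj q : X q -> exists2 b, cone flags b & forall j, q j = lin b j.
Proof.
have [k] := ubnP #|supp q|; elim: k => // k IH in q *; rewrite ltnS => qk qX.
have [q0|q0] := eqVneq (supp q) finset.set0.
  exists [ffun=> 0].
    apply: cone0; rewrite inE; apply/forall_inP => w; by rewrite inE.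
  move=> j; rewrite /lin big1 => [|w _]; last by rewrite ffunE mul0r.
  by apply/eqP; move/setP/(_ j): q0; rewrite !inE => /negbFE.
have [w ww] := cell_supp qX q0.
have /set0Pn[j0 j0q] := q0.
have [i iq imin] := @Order.TotalTheory.arg_minP _ _ _ j0 (mem (supp q))
  (fun j => q j / y w j) j0q.
rewrite /= in iq imin.
have yi : 0 < y w i by rewrite cell_gt0 // ww.
pose t := q i / y w i.
have t0 : 0 <= t by rewrite divr_ge0 ?(ltW yi) // (X_ge0 qX).
have q1_ge0 j : 0 <= q j + (- t) * y w j.
  have [jq|jq] := boolP (j \in supp q).
    by rewrite mulNr subr_ge0 -ler_pdivlMr ?imin // cell_gt0 // ww.
  by rewrite cell_eq0 ?ww // mulr0 addr0 (X_ge0 qX).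
pose q1 : {ffun U -> R} := [ffun j => q j + (- t) * y w j].
have q1X : X q1 by apply: X_add => //; rewrite y_supp ww fintype.subxx.
have q1q : supp q1 \proper supp q.
  apply/fintype.properP; split.
    apply/fintype.subsetP => j; rewrite inE ffunE; apply: contraR => jq.
    by rewrite cell_eq0 ?ww // mulr0 addr0; rewrite inE negbK in jq.
  by exists i => //; rewrite inE ffunE mulNr /t divfK ?subrr ?eqxx // gt_eqF.
have [b1 b1c b1E] := IH q1 (leq_trans (proper_card q1q) qk) q1X.
have [b10 b1K] := b1c.
have b1_sub w' : w' \in supp b1 -> val w' \subset supp q1.
  move=> w'b; apply/fintype.subsetP => j jw'; rewrite inE b1E lin_neq0 //.
  by apply/exists_inP; exists w'.
exists [ffun w' => b1 w' + t * (w' == w)%:R].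
  split=> [w'|]; first by rewrite ffunE addr_ge0 // (mulr_ge0 t0) ?ler0n.
  apply: (@flags_down (w |: supp b1)).
    apply/fintype.subsetP => w'; rewrite !inE ffunE.
    by have [//|_] := eqVneq w' w; rewrite mulr0 addr0.
  have wtop w' : w' \in supp b1 -> val w' \subset val w.
    move=> /b1_sub/fintype.subset_trans; apply; rewrite ww; exact: proper_sub.
  rewrite inE; apply/forall_inP => a; rewrite finset.in_setU1 => /predU1P[->|ab].
    apply/forall_inP => b; rewrite finset.in_setU1 => /predU1P[->|/wtop ->].
      by rewrite fintype.subxx.
    by rewrite orbT.
  apply/forall_inP => b; rewrite finset.in_setU1 => /predU1P[->|bb].
    by rewrite wtop.
  by move: b1K; rewrite inE => /forall_inP/(_ _ ab)/forall_inP/(_ _ bb).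
move=> j; rewrite /lin; under eq_bigr => w' _ do rewrite ffunE mulrDl.
rewrite big_split /= -/(lin b1 j) -b1E ffunE mulNr addrAC -addrA [X in _ + X]addrC.
rewrite (bigD1 w) //= eqxx mulr1 big1 ?addr0 ?addNr ?addr0 //.
by move=> w' /negbTE ->; rewrite mulr0 mul0r.
Qed.

Lemma flags_inj b b' : cone flags b -> cone flags b' ->
  (forall j, lin b j = lin b' j) -> b = b'.
Proof.
have [k] := ubnP #|[set j | lin b j != 0]|.
elim: k => // k IH in b b' *; rewrite ltnS => bk bc bc' bb'.
have [b0 bK] := bc; have [b'0 b'K] := bc'.
have zero (c : {ffun cell -> R}) : (forall w, 0 <= c w) ->
    (forall j, lin c j = 0) -> c = [ffun=> 0].
  move=> c0 cl; apply/ffunP => w; rewrite ffunE; apply/eqP/negPn/negP => cw.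
  have /andP[/set0Pn[j jw] _] : cell_pred (val w) := valP w.
  have : [exists w in supp c, j \in val w].
    by apply/exists_inP; exists w; rewrite ?inE.
  by rewrite -lin_neq0 // cl eqxx.
have [e|/set0Pn[w0 w0b]] := eqVneq (supp b) finset.set0.
  have l0 j : lin b j = 0.
    rewrite /lin big1 // => w _; move/setP/(_ w): e.
    by rewrite !inE => /negbFE/eqP ->; rewrite mul0r.
  by rewrite (zero b b0 l0); apply/esym/zero => // j; rewrite -bb'.
have [e|/set0Pn[w0' w0b']] := eqVneq (supp b') finset.set0.
  have l0 j : lin b' j = 0.
    rewrite /lin big1 // => w _; move/setP/(_ w): e.
    by rewrite !inE => /negbFE/eqP ->; rewrite mul0r.
  by rewrite (zero b' b'0 l0); apply: zero => // j; rewrite bb'.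
have [w wb wtop] := flags_top bK w0b; have [w' wb' wtop'] := flags_top b'K w0b'.
have ww' : w = w'.
  apply/val_inj/setP => j.
  by rewrite -(lin_top bc wb wtop) -(lin_top bc' wb' wtop') bb'.
(* Both combinations have the same leading cell; subtract the smaller of the
   two leading coefficients. *)
subst w'; pose t := Num.min (b w) (b' w).
pose sub (c : {ffun cell -> R}) : {ffun cell -> R} := [ffun v => c v - t * (v == w)%:R].
have subc c : cone flags c -> t <= c w -> cone flags (sub c).
  move=> [c0 cK] tc; split=> [v|].
    rewrite ffunE; have [->|_] := eqVneq v w; first by rewrite mulr1 subr_ge0.
    by rewrite mulr0 subr0.
  apply: flags_down cK; apply/fintype.subsetP => v; rewrite !inE ffunE.
  have [->|_] := eqVneq v w; last by rewrite mulr0 subr0.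
  have t0 : 0 < t.
    rewrite inE in wb; rewrite inE in wb'.
    by rewrite /t lt_min !lt_def b0 b'0 !andbT wb wb'.
  by rewrite (gt_eqF (lt_le_trans t0 tc)).
have sublin c j : lin (sub c) j = lin c j - t * y w j.
  rewrite /lin; under eq_bigr => v _ do rewrite ffunE mulrBl.
  rewrite sumrB; congr (_ - _); rewrite (bigD1 w) //= eqxx mulr1 big1 ?addr0 //.
  by move=> v /negbTE ->; rewrite mulr0 mul0r.
have tb : t <= b w by rewrite /t ge_min lexx.
have tb' : t <= b' w by rewrite /t ge_min lexx orbT.
(* A combination whose leading coefficient is exactly [t] loses its leading cell, so the support of
   its value shrinks. *)
have small c : cone flags c -> (forall v, v \in supp c -> val v \subset val w) ->
    c w = t -> [set j | lin (sub c) j != 0] \proper val w.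
  move=> cc ctop cwt; have sc : cone flags (sub c) by apply: subc; rewrite ?cwt.
  have wn0 : val w != finset.set0 by have /andP[] : cell_pred (val w) := valP w.
  have scw v : v \in supp (sub c) -> v != w /\ v \in supp c.
    rewrite !inE ffunE; have [->|_] := eqVneq v w.
      by rewrite mulr1 cwt subrr eqxx.
    by rewrite mulr0 subr0.
  have [e|/set0Pn[u u_in]] := eqVneq (supp (sub c)) finset.set0.
    rewrite (_ : [set j | _] = finset.set0) ?finset.proper0 //.
    apply/setP => j; rewrite inE lin_neq0; last by case: sc.
    by rewrite inE; apply/exists_inP => -[v]; rewrite e inE.
  have [v vb vtop] := flags_top (proj2 sc) u_in; have [vw vc] := scw v vb.
  rewrite (_ : [set j | _] = val v).
    by rewrite finset.properEneq ctop // andbT (inj_eq val_inj).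
  by apply/setP => j; rewrite inE (lin_top sc vb vtop).
have lw : [set j | lin b j != 0] = val w.
  by apply/setP => j; rewrite inE (lin_top bc wb wtop).
rewrite lw in bk.
suff e : sub b = sub b'.
  by apply/ffunP => v; move/ffunP/(_ v): e; rewrite !ffunE => /addIr.
apply: IH; [|exact: subc|exact: subc|by move=> j; rewrite !sublin bb'].
apply: leq_trans bk; apply: proper_card.
have [tE|tE] : t = b w \/ t = b' w.
- by rewrite /t; case: leP; [left|right].
- exact: small.
rewrite (_ : [set j | _] = [set j | lin (sub b') j != 0]); first exact: small.
by apply/setP => j; rewrite !inE !sublin bb'.
Qed.


(** [h] selects some coordinates of the points of [X]. The same flags refine every complex for which
    this projection is a bijection from [X] onto its cone. *)
Lemma flags_refines (V : finType) (K : {set {set V}}) (h : V -> U) :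
  (forall q, X q -> cone K [ffun v => q (h v)]) ->
  (forall a, cone K a -> exists2 q, X q & forall v, q (h v) = a v) ->
  (forall q q', X q -> X q' -> (forall v, q (h v) = q' (h v)) -> q = q') ->
  refines flags K (fun w => [ffun v => y w (h v)]).
Proof.
move=> Xcone Xsurj Xinj; have linE b v :
    linear_extension (fun w => [ffun v => y w (h v)]) b v = lin b (h v).
  by rewrite ffunE; apply: eq_bigr => w _; rewrite ffunE.
split.
- by move=> w v; rewrite ffunE X_ge0.
- move=> w; apply: contrapT => H.
  have y0 : y w = [ffun=> 0].
    apply: Xinj => // v; rewrite ffunE; apply/eqP/negPn/negP => yv.
    by apply: H; exists v; rewrite ffunE.
  have /andP[/negP[]] : cell_pred (val w) := valP w.
  by rewrite -y_supp y0; apply/eqP/setP => j; rewrite !inE ffunE eqxx.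
- move=> c cK; have [->|/set0Pn[w0 w0c]] := eqVneq c finset.set0.
    have [_ sK] := Xcone _ X0; exists (supp [ffun v => [ffun=> 0 : R] (h v)]) => // w v.
    by rewrite inE.
  have [w wc wtop] := flags_top cK w0c; have [_ sK] := Xcone _ (yX w).
  exists (supp [ffun v => y w (h v)]) => // w' v w'c; rewrite inE !ffunE => yv.
  have /fintype.subsetP/(_ (h v)) := wtop _ w'c.
  by rewrite -!y_supp !inE; apply.
- move=> a /Xsurj[q qX qa]; have [b bc qb] := flags_surj qX; exists b => //.
  by apply/ffunP => v; rewrite linE -qb.
- move=> b b' bc b'c bb'; apply: flags_inj => // j.
  suff /ffunP/(_ j) : [ffun j => lin b j] = [ffun j => lin b' j] by rewrite !ffunE.
  apply: Xinj; try exact: lin_in_X.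
  by move=> v; rewrite !ffunE -!linE bb'.
Qed.

End Barycentric.

Section PL.
Variable R : realType.

Lemma cone_addZ (V : finType) (K : {set {set V}}) (a a' : {ffun V -> R}) t :
  down_closed K -> cone K a -> supp a' \subset supp a ->
  (forall v, 0 <= a v + t * a' v) -> cone K [ffun v => a v + t * a' v].
Proof.
move=> Kd [_ aK] /fintype.subsetP aa H; split=> [v|]; first by rewrite ffunE.
apply: Kd aK; apply/fintype.subsetP => v; apply: contraTT => va.
have va' : v \notin supp a' by apply: contra va => /aa.
move: va va'; rewrite !inE !negbK => /eqP va /eqP va'.
by rewrite ffunE va va' mulr0 addr0.
Qed.

(** A point of space is encoded by the pair of its coordinate vectors in the two fans, and the
    support of the pair names the two cones that contain it. Both projections of [X] are bijective
    because both fans are complete. *)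
Lemma common_refinement n (V1 V2 : finType) (K1 : {set {set V1}})
    (K2 : {set {set V2}}) (x1 : V1 -> 'rV[R]_n) (x2 : V2 -> 'rV[R]_n) :
  fan K1 x1 -> fan K2 x2 ->
  exists (W : finType) (K' : {set {set W}}) y1 y2,
    [/\ simplicial_complex K', refines K' K1 (y1 : W -> {ffun V1 -> R}) &
        refines K' K2 (y2 : W -> {ffun V2 -> R})].
Proof.
move=> F1 F2.
pose l (q : {ffun V1 + V2 -> R}) : {ffun V1 -> R} := [ffun v => q (inl v)].
pose r (q : {ffun V1 + V2 -> R}) : {ffun V2 -> R} := [ffun v => q (inr v)].
pose X q := [/\ cone K1 (l q), cone K2 (r q) &
  \sum_v l q v *: x1 v = \sum_v r q v *: x2 v].
have X0 : X [ffun=> 0].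
  have l0 : l [ffun=> 0] = [ffun=> 0] by apply/ffunP => v; rewrite !ffunE.
  have r0 : r [ffun=> 0] = [ffun=> 0] by apply/ffunP => v; rewrite !ffunE.
  rewrite /X l0 r0; split; try by apply: cone0; apply: fan_set0; eassumption.
  by rewrite !big1 // => v _; rewrite ffunE scale0r.
have X_ge0 q : X q -> forall j, 0 <= q j.
  by move=> [[l0 _] [r0 _] _] [v|v]; [have := l0 v|have := r0 v]; rewrite ffunE.
have X_add q q' t : X q -> X q' -> supp q' \subset supp q ->
    (forall j, 0 <= q j + t * q' j) -> X [ffun j => q j + t * q' j].
  move=> [lq rq e] [lq' rq' e'] /fintype.subsetP qq H.
  have lE : l [ffun j => q j + t * q' j] = [ffun v => l q v + t * l q' v].
    by apply/ffunP => v; rewrite !ffunE.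
  have rE : r [ffun j => q j + t * q' j] = [ffun v => r q v + t * r q' v].
    by apply/ffunP => v; rewrite !ffunE.
  rewrite /X lE rE; split.
  - apply: cone_addZ (fan_down F1) lq _ _; last by move=> v; rewrite !ffunE.
    by apply/fintype.subsetP => v; have := qq (inl v); rewrite !inE !ffunE.
  - apply: cone_addZ (fan_down F2) rq _ _; last by move=> v; rewrite !ffunE.
    by apply/fintype.subsetP => v; have := qq (inr v); rewrite !inE !ffunE.
  - under eq_bigr => v _ do rewrite ffunE scalerDl -scalerA.
    under [RHS]eq_bigr => v _ do rewrite ffunE scalerDl -scalerA.
    by rewrite !big_split /= -!scaler_sumr e e'.
have [y Hy] : {y : cell X -> {ffun V1 + V2 -> R} &
    forall w, X (y w) /\ supp (y w) = val w}.
  apply: (@choice _ _ (fun w q => X q /\ supp q = val w)) => w.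
  have /andP[_ /asboolP[q qX qw]] : cell_pred X (val w) := valP w.
  by exists q.
have yX w : X (y w) by case: (Hy w).
have yS w : supp (y w) = val w by case: (Hy w).
have X_inj q q' : X q -> X q' -> l q = l q' \/ r q = r q' -> q = q'.
  move=> [lq rq e] [lq' rq' e'] H.
  have [el er] : l q = l q' /\ r q = r q'.
    case: H => E; split=> //; [apply: (fan_inj F2)|apply: (fan_inj F1)] => //.
      by rewrite -e -e' E.
    by rewrite e e' E.
  apply/ffunP => -[v|v].
    by move/ffunP/(_ v): el; rewrite !ffunE.
  by move/ffunP/(_ v): er; rewrite !ffunE.
have ref1 : refines (flags X) K1 (fun w => [ffun v => y w (inl v)]).
  apply: (flags_refines X0 X_ge0 X_add yX yS) => [q []//|a ac|q q' qX q'X e].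
    have [b bc be] := fan_surj F2 (\sum_v a v *: x1 v).
    pose q : {ffun V1 + V2 -> R} := [ffun j => match j with inl v => a v | inr v => b v end].
    have lq : l q = a by apply/ffunP => v; rewrite !ffunE.
    have rq : r q = b by apply/ffunP => v; rewrite !ffunE.
    by exists q => [|v]; rewrite ?/X ?lq ?rq // ffunE.
  by apply: X_inj => //; left; apply/ffunP => v; rewrite !ffunE.
have ref2 : refines (flags X) K2 (fun w => [ffun v => y w (inr v)]).
  apply: (flags_refines X0 X_ge0 X_add yX yS) => [q []//|b bc|q q' qX q'X e].
    have [a ac ae] := fan_surj F1 (\sum_v b v *: x2 v).
    pose q : {ffun V1 + V2 -> R} := [ffun j => match j with inl v => a v | inr v => b v end].
    have lq : l q = a by apply/ffunP => v; rewrite !ffunE.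
    have rq : r q = b by apply/ffunP => v; rewrite !ffunE.
    by exists q => [|v]; rewrite ?/X ?lq ?rq // ffunE.
  by apply: X_inj => //; right; apply/ffunP => v; rewrite !ffunE.
exists (cell X), (flags X), (fun w => [ffun v => y w (inl v)]),
  (fun w => [ffun v => y w (inr v)]); split=> //.
apply: fan_complex (refines_fan ref1 (fan_down F1) (@flags_down _ _ X) F1) _.
exact: flags1.
Qed.

Lemma fan_pl_sphere n (V : finType) (K : {set {set V}}) (x : V -> 'rV[R]_n) :
  fan K x -> (forall v, [set v] \in K) -> pl_sphere R K.
Proof.
move=> F K1; split; first exact: fan_complex F K1.
have [W [K' [y1 [y2 [K'c r1 r2]]]]] := common_refinement F (simplex_fan R n).
exists W, W, K', K', n; split.
- exact: refines_subdivision r1 (fan_down F) K'c.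
- exact: refines_subdivision r2 (fan_down (simplex_fan R n)) K'c.
- by exists id => [|s]; [exists id|rewrite imset_id].
Qed.

End PL.

(** * Linear programming duality *)

Lemma sumr_ge0_eq0 (R : realDomainType) (I : finType) (F : I -> R) :
  (forall i, 0 <= F i) -> \sum_i F i = 0 -> forall i, F i = 0.
Proof. by move=> F0 S i; apply: (psumr_eq0P _ S). Qed.

Section LinearForms.
Variables (R : realType) (m : nat).

Lemma linear_form_continuous (l : 'I_m -> R) :
  continuous (fun v : 'rV[R]_m => \sum_i l i * v 0 i).
Proof.
apply: continuous_big => [|i _]; first exact: add_continuous.
by move=> v; apply: continuousM; [exact: cst_continuous|exact: coord_continuous].
Qed.

End LinearForms.

Section GaleComplex.
Variables (R : realType) (m p : nat) (B : 'I_m -> 'rV[R]_p) (g : 'rV[R]_p).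
Variables (A : 'I_m -> 'rV[int]_p) (d : R).
Hypothesis G : gale B g A d.

Definition gale_complex : {set {set 'I_m}} := [set s | `[< face B g s >]].
Let K := gale_complex.

Lemma gale_complexP s : reflect (face B g s) (s \in K).
Proof. by rewrite inE; apply: asboolP. Qed.

Definition relation (c : 'I_m -> R) := \sum_i c i *: B i = 0.

Lemma relationD c c' t : relation c -> relation c' ->
  relation (fun i => c i + t * c' i).
Proof.
rewrite /relation => c0 c'0; under eq_bigr => i _ do rewrite scalerDl -scalerA.
by rewrite big_split /= -scaler_sumr c0 c'0 scaler0 addr0.
Qed.

Lemma relation_sum (I : finType) (P : pred I) (t : I -> R) (c : I -> 'I_m -> R) :
  (forall i, P i -> relation (c i)) -> relation (fun k => \sum_(i | P i) t i * c i k).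
Proof.
rewrite /relation => H; under eq_bigr => k _ do rewrite scaler_suml.
rewrite exchange_big big1 // => i /H Pi.
by under eq_bigr => k _ do rewrite -scalerA; rewrite -scaler_sumr Pi scaler0.
Qed.

Lemma relation_feasible u v : feasible B g u -> feasible B g v ->
  relation (fun i => u i - v i).
Proof.
rewrite /relation => -[_ ug] [_ vg]; under eq_bigr => i _ do rewrite scalerBl.
by rewrite sumrB ug vg subrr.
Qed.

Lemma feasible_relation u c t : feasible B g u -> relation c ->
  (forall i, 0 <= u i + t * c i) -> feasible B g (fun i => u i + t * c i).
Proof.
move=> [u0 ug] c0 H; split=> //.
under eq_bigr => i _ do rewrite scalerDl -scalerA.
by rewrite big_split /= -scaler_sumr ug c0 scaler0 addr0.
Qed.

Lemma relation_ge0 c : relation c -> (forall i, 0 <= c i) -> forall i, c i = 0.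
Proof.
move=> cr c0; have [l lB] := gale_bounded G.
have : (\sum_i c i *: B i) *m l = 0 by rewrite cr mul0mx.
rewrite mulmx_suml => /matrixP/(_ 0 0); rewrite summxE mxE.
under eq_bigr => i _ do rewrite -scalemxAl mxE.
move=> S0 i; apply/eqP; have /eqP := sumr_ge0_eq0 (fun k => mulr_ge0 (c0 k) (ltW (lB k))) S0 i.
by rewrite mulf_eq0 (gt_eqF (lB i)) orbF.
Qed.

Lemma feasible_step u c : feasible B g u -> relation c ->
  (forall i, u i = 0 -> 0 <= c i) ->
  exists2 t, 0 < t & feasible B g (fun i => u i + t * c i).
Proof.
move=> fu cr c0; have [u0 _] := fu.
suff [t t0 H] : exists2 t, 0 < t & forall i, 0 <= u i + t * c i.
  by exists t => //; exact: feasible_relation.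
apply: uniform_pos => [i a b b0 ba H|i].
  have [ci|ci] := leP 0 (c i); first by rewrite addr_ge0 ?mulr_ge0 // ltW.
  by apply: le_trans H _; rewrite lerD2l ler_wnM2r // ltW.
have [ui|ui] := eqVneq (u i) 0; first by exists 1; rewrite // ui add0r mul1r c0.
have n1 : 0 < 1 + `|c i| by rewrite ltr_pwDl.
exists (u i / (1 + `|c i|)); first by rewrite divr_gt0 // lt_def ui u0.
rewrite -[X in X + _](@divfK _ (1 + `|c i|)) ?gt_eqF // -mulrDr mulr_ge0 //.
  by rewrite divr_ge0 // ltW.
by have := ler_norm (- c i); rewrite normrN; lra.
Qed.

Lemma feasible_bounded : exists M : 'I_m -> R, forall u, feasible B g u ->
  forall i, u i <= M i.
Proof.
have [l lB] := gale_bounded G; exists (fun i => (g *m l) 0 0 / (B i *m l) 0 0).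
move=> u [u0 <-] i; have E k : (u k *: B k *m l) 0 0 = u k * (B k *m l) 0 0.
  by rewrite -scalemxAl mxE.
rewrite ler_pdivlMr // mulmx_suml summxE (bigD1 i) //= E lerDl sumr_ge0 // => k _.
by rewrite E mulr_ge0 // ltW.
Qed.

Lemma feasible_min (l : 'I_m -> R) : (exists u, feasible B g u) ->
  exists2 u, feasible B g u & forall v, feasible B g v ->
    \sum_i l i * u i <= \sum_i l i * v i.
Proof.
move=> [u fu]; have [M MP] := feasible_bounded.
pose P : set 'rV[R]_m := [set v | feasible B g (fun i => v 0 i)]%classic.
have rowP v : feasible B g v -> P (\row_i v i).
  move=> [v0 vg]; split=> [i|]; first by rewrite mxE.
  by rewrite -vg; apply: eq_bigr => i _; rewrite mxE.
have Pcompact : compact P.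
  pose box : set 'rV[R]_m := [set v : 'rV[R]_m |
    forall i, (`[0, M i]%classic : set R) (v 0 i)]%classic.
  apply: (@subclosed_compact _ _ box).
  - rewrite (_ : P = \bigcap_(i in setT) (fun v : 'rV[R]_m => v 0 i) @^-1` [set x | 0 <= x]
      `&` \bigcap_(k in setT) (fun v : 'rV[R]_m => \sum_i B i 0 k * v 0 i) @^-1`
          [set x | x = g 0 k])%classic.
      apply: closedI; apply: closed_bigI => k _; apply: preimage_closed.
      + by move=> v _; exact: coord_continuous.
      + exact: closed_ge.
      + by move=> v _; exact: linear_form_continuous.
      + exact: closed_eq.
    apply/seteqP; split=> [v [v0 vg]|v [v0 vg]]; split.
    + by move=> i _; exact: v0.
    + move=> k _ /=; rewrite -vg summxE; apply: eq_bigr => i _.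
      by rewrite !mxE mulrC.
    + by move=> i; exact: v0.
    + apply/matrix.rowP => k; rewrite -(vg k I) summxE; apply: eq_bigr => i _.
      by rewrite !mxE mulrC.
  - by apply: (@rV_compact R m (fun i => `[0, M i]%classic)) => i; exact: segment_compact.
  - move=> v fv i; rewrite /= in_itv /=; apply/andP; split; first by case: fv.
    exact: MP fv i.
have P0 : (P !=set0)%classic by exists (\row_i u i); exact: rowP.
have [|w wP wmin] := @EVT_min_rV _ _ (fun v : 'rV[R]_m => \sum_i l i * v 0 i) _ P0 Pcompact.
  by apply: continuous_subspaceT; exact: linear_form_continuous.
exists (fun i => w 0 i); first by rewrite inE in wP.
move=> v fv; have /wmin : \row_i v i \in P by rewrite inE; exact: rowP.
by move=> /le_trans; apply; apply: ler_sum => i _; rewrite mxE.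
Qed.

(* The edges of the simple polytope at [u]: increase the coordinate [i], and
   correct by the columns of the support. *)
Lemma edge_relations u : feasible B g u -> exists w : 'I_m -> 'I_m -> R,
  forall i, u i = 0 -> relation (w i) /\ forall k, u k = 0 -> w i k = (k == i)%:R.
Proof.
move=> fu; have /choice[c cE] : forall i, exists c : 'I_m -> R,
    B i = \sum_(k in [set k | u k != 0]) c k *: B k.
  by move=> i; have [c ->] := spanB_supp G fu (B i); exists c.
exists (fun i k => if u k == 0 then (k == i)%:R else - c i k) => i ui.
split=> [|k ->]; last by rewrite eqxx.
rewrite /relation (bigID (fun k => u k == 0)) /= (bigD1 i) /=; last exact/eqP.
rewrite ui !eqxx scale1r big1 ?addr0 => [|k /andP[-> /negbTE ->]]; last first.
  by rewrite scale0r.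
rewrite [X in X + _]cE (eq_bigl (fun k => u k != 0)) => [|k]; last by rewrite inE.
by rewrite -big_split big1 //= => k /negbTE ->; rewrite scaleNr subrr.
Qed.

(* Complementary slackness: the reduced costs at a minimizer are nonnegative and
   supported on its zero set. *)
Lemma relation_dual (l : 'I_m -> R) : (exists u, feasible B g u) ->
  exists2 a : {ffun 'I_m -> R}, cone K a &
    forall c, relation c -> \sum_i a i * c i = \sum_i l i * c i.
Proof.
move=> /(feasible_min l)[u fu umin]; have [u0 _] := fu.
have [w wP] := edge_relations fu.
have incr c : relation c -> (forall i, u i = 0 -> 0 <= c i) -> 0 <= \sum_i l i * c i.
  move=> cr c0; have [t t0 /umin] := feasible_step fu cr c0.
  under [leRHS]eq_bigr => i _ do rewrite mulrDr mulrCA.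
  by rewrite big_split /= lerDl -mulr_sumr pmulr_rge0.
have const c : relation c -> (forall i, u i = 0 -> c i = 0) -> \sum_i l i * c i = 0.
  move=> cr c0; apply/eqP; rewrite eq_le incr ?andbT => [|//|i /c0 ->//].
  have cN : relation (fun i => 0 + (-1) * c i).
    by apply: relationD => //; rewrite /relation big1 // => i _; rewrite scale0r.
  have := incr _ cN; under eq_bigr => i _ do rewrite add0r mulN1r mulrN.
  by rewrite sumrN oppr_ge0; apply=> i /c0 ->; rewrite mulr0 addr0.
pose a : {ffun 'I_m -> R} := [ffun i => if u i == 0 then \sum_k l k * w i k else 0].
exists a.
  split=> [i|].
    rewrite ffunE; case: ifP => // /eqP ui; have [wr wk] := wP i ui.
    by apply: incr => // k /wk ->; rewrite ler0n.
  apply/gale_complexP; apply: (face_sub (spanB_supp G) fu) => i.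
  by rewrite inE ffunE; case: ifP => [/eqP//|]; rewrite eqxx.
(* Subtracting the edge directions leaves a relation that vanishes on the zeros of [u], on which
   [const] makes [l] vanish. *)
move=> c cr; pose c' k := c k + (-1) * \sum_(i | u i == 0) c i * w i k.
have c'r : relation c'.
  apply: relationD => //; apply: relation_sum => i /eqP ui; by case: (wP i ui).
have c'0 k : u k = 0 -> c' k = 0.
  move=> uk; rewrite /c' (bigD1 k) /=; last exact/eqP.
  have [_ ->//] := wP k uk; rewrite eqxx mulr1 big1 ?addr0 ?mulN1r ?subrr //.
  move=> i /andP[/eqP ui ik]; have [_ ->//] := wP i ui.
  by rewrite eq_sym (negbTE ik) mulr0.
have := const c' c'r c'0; rewrite /c'.
under eq_bigr => k _ do rewrite mulrDr mulN1r mulrN.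
rewrite sumrB => /eqP; rewrite subr_eq0 => /eqP ->.
rewrite (bigID (fun i => u i == 0)) /= [X in _ + X]big1 ?addr0; last first.
  by move=> i /negbTE ui; rewrite ffunE ui mul0r.
under [RHS]eq_bigr => k _ do rewrite mulr_sumr.
rewrite exchange_big; apply: eq_bigr => i ui; rewrite ffunE ui mulr_suml.
by apply: eq_bigr => k _; rewrite mulrCA mulrA mulrC mulrA.
Qed.

(** Let [u] and [v] vanish exactly on the supports of [a] and [b]. Pairing with the relation [u - v]
    equates a nonpositive and a nonnegative sum, so both are zero and the supports agree. The edge
    relations at [u] then isolate each coefficient. *)
Lemma relation_cone_inj (a b : {ffun 'I_m -> R}) : cone K a -> cone K b ->
  (forall c, relation c -> \sum_i a i * c i = \sum_i b i * c i) -> a = b.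
Proof.
move=> [a0 /gale_complexP[u fu ua]] [b0 /gale_complexP[v fv vb]] ab.
have uE i : (u i == 0) = (a i != 0) by rewrite ua inE.
have vE i : (v i == 0) = (b i != 0) by rewrite vb inE.
have [[u0 _] [v0 _]] := (fu, fv).
have := ab _ (relation_feasible fu fv).
have -> : \sum_i a i * (u i - v i) = - \sum_i a i * v i.
  rewrite -sumrN; apply: eq_bigr => i _; rewrite mulrBr.
  have [ui|ui] := eqVneq (u i) 0; first by rewrite ui mulr0 add0r.
  by move: ui; rewrite uE negbK => /eqP ->; rewrite !mul0r subrr oppr0.
have -> : \sum_i b i * (u i - v i) = \sum_i b i * u i.
  apply: eq_bigr => i _; rewrite mulrBr.
  have [vi|vi] := eqVneq (v i) 0; first by rewrite vi mulr0 subr0.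
  by move: vi; rewrite vE negbK => /eqP ->; rewrite !mul0r subrr.
have S1 : 0 <= \sum_i a i * v i by apply: sumr_ge0 => i _; rewrite mulr_ge0.
have S2 : 0 <= \sum_i b i * u i by apply: sumr_ge0 => i _; rewrite mulr_ge0.
move=> S; have S10 : \sum_i a i * v i = 0 by lra.
have S20 : \sum_i b i * u i = 0 by lra.
have uv i : (u i == 0) = (v i == 0).
  apply/idP/idP => [|]; rewrite ?uE ?vE.
    have := sumr_ge0_eq0 (fun k => mulr_ge0 (a0 k) (v0 k)) S10 i.
    by move/eqP; rewrite mulf_eq0 => /orP[->//|]; rewrite vE.
  have := sumr_ge0_eq0 (fun k => mulr_ge0 (b0 k) (u0 k)) S20 i.
  by move/eqP; rewrite mulf_eq0 => /orP[->//|]; rewrite uE.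
have [w wP] := edge_relations fu.
apply/ffunP => i; have [ui|ui] := eqVneq (u i) 0; last first.
  have := ui; rewrite uE negbK => /eqP ->; have := ui; rewrite uv vE negbK.
  by move=> /eqP ->.
have [wr wk] := wP i ui; have := ab _ wr.
have pick (f : {ffun 'I_m -> R}) : (forall k, u k != 0 -> f k = 0) ->
    \sum_k f k * w i k = f i.
  move=> f0; rewrite (bigD1 i) //= wk // eqxx mulr1 big1 ?addr0 // => k ki.
  have [uk|uk] := eqVneq (u k) 0; first by rewrite wk // (negbTE ki) mulr0.
  by rewrite f0 // mul0r.
rewrite !pick // => k; first by rewrite uv vE negbK => /eqP.
by rewrite uE negbK => /eqP.
Qed.

End GaleComplex.

(** * The boundary complex of a Gale configuration *)

Section GaleFan.
Variables (R : realType) (m p : nat) (B : 'I_m -> 'rV[R]_p) (g : 'rV[R]_p).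
Variables (A : 'I_m -> 'rV[int]_p) (d : R).
Hypothesis G : gale B g A d.
Hypothesis m0 : (0 < m)%N.
Let K : {set {set 'I_m}} := gale_complex B g.

(* The Gale dual of [B]: its columns form a basis of the relations. *)
Let Bm : 'M[R]_(m, p) := \matrix_i B i.
Let n := \rank (kermx Bm).
Let X : 'M[R]_(m, n) := (row_base (kermx Bm))^T.
Definition gale_rays (i : 'I_m) : 'rV[R]_n := row i X.
Let x := gale_rays.

Lemma face0 : face B g finset.set0.
Proof.
by apply: (face_subset G) (gale_vertex G (Ordinal m0)); exact: finset.sub0set.
Qed.

Lemma gale_dim : n = (m - p)%N.
Proof.
rewrite /n mxrank_ker; congr (_ - _)%N; apply/eqP; rewrite -[_ == p]/(row_full Bm).
rewrite -sub1mx; apply/row_subP => k.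
have [u fu _] := face0; have [c ->] := spanB_supp G fu (row k 1%:M).
apply: summx_sub => i _; apply: scalemx_sub; rewrite -[B i](rowK B).
exact: row_sub.
Qed.

Lemma relationP (c : 'I_m -> R) :
  relation B c <-> exists e : 'rV[R]_n, forall i, c i = \sum_j e 0 j * x i 0 j.
Proof.
have cB : (\row_i c i) *m Bm = \sum_i c i *: B i.
  by rewrite mulmx_sum_row; apply: eq_bigr => i _; rewrite mxE rowK.
split=> [cr|[e ce]].
  have : ((\row_i c i) <= row_base (kermx Bm))%MS.
    by rewrite eq_row_base; apply/sub_kermxP; rewrite cB.
  case/submxP => e /rowP ce; exists e => i; have := ce i; rewrite !mxE => ->.
  by apply: eq_bigr => j _; rewrite !mxE.
rewrite /relation -cB; apply/sub_kermxP; rewrite -(eq_row_base (kermx Bm)).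
apply/submxP; exists e; apply/rowP => i; rewrite !mxE ce.
by apply: eq_bigr => j _; rewrite !mxE.
Qed.

Lemma gale_raysP (a b : 'I_m -> R) : \sum_i a i *: x i = \sum_i b i *: x i <->
  forall c, relation B c -> \sum_i a i * c i = \sum_i b i * c i.
Proof.
have E (a' : 'I_m -> R) (e : 'rV[R]_n) :
    \sum_i a' i * (\sum_j e 0 j * x i 0 j) = \sum_j e 0 j * (\sum_i a' i *: x i) 0 j.
  under eq_bigr => i _ do rewrite mulr_sumr.
  rewrite exchange_big; apply: eq_bigr => j _; rewrite summxE mulr_sumr.
  by apply: eq_bigr => i _; rewrite [(a' i *: x i) 0 j]mxE mulrCA.
split=> [ab c /relationP[e ce]|H].
  under eq_bigr => i _ do rewrite ce.
  by under [RHS]eq_bigr => i _ do rewrite ce; rewrite !E ab.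
apply/rowP => k; pose e : 'rV[R]_n := delta_mx 0 k.
have ek (v : 'rV[R]_n) : \sum_j e 0 j * v 0 j = v 0 k.
  rewrite (bigD1 k) //= !mxE !eqxx mul1r big1 ?addr0 // => j jk.
  by rewrite !mxE (negbTE jk) mul0r.
have /H : relation B (fun i => \sum_j e 0 j * x i 0 j) by apply/relationP; exists e.
by rewrite !E !ek.
Qed.

(** Points of the space are functionals on the relations, by [gale_raysP]. Coordinates exist by
    [relation_dual] and are unique by [relation_cone_inj]. *)
Lemma gale_fan : fan K x.
Proof.
split=> [s t ts /gale_complexP fs|a b aK bK /gale_raysP|y].
- by apply/gale_complexP; apply: (face_subset G) ts fs.
- exact: relation_cone_inj G _ _ aK bK.
have /submxP[l ->] : (y <= X)%MS.
  apply: submx_full; rewrite /row_full mxrank_tr eq_row_base; exact/eqP.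
have [u fu _] := face0.
have [|a aK al] := relation_dual G (fun i => l 0 i); first by exists u.
by exists a => //; rewrite mulmx_sum_row; apply/gale_raysP.
Qed.

Lemma gale_complex1 v : [set v] \in K.
Proof. by apply/gale_complexP; exact: gale_vertex G v. Qed.

Lemma gale_complex_simplicial : simplicial_complex K.
Proof. exact: fan_complex gale_fan gale_complex1. Qed.

Lemma gale_pl_sphere : pl_sphere R K.
Proof. exact: fan_pl_sphere gale_fan gale_complex1. Qed.

Lemma gale_facet : exists2 s, facet K s & #|s| = (m - p)%N.
Proof.
have [s sK _] := fan_facet_exists gale_fan; exists s => //.
by rewrite (fan_pure gale_fan sK) -gale_dim.
Qed.

Lemma gale_complex_dim : complex_dim K = (m - p)%N%:Z - 1.
Proof.
have [s sF smax] := fan_facet_exists gale_fan; have [sK _] := sF.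
rewrite /complex_dim -gale_dim -(fan_pure gale_fan sF); congr (Posz _ - 1).
apply/eqP; rewrite eqn_leq; apply/andP; split; first exact/bigmax_leqP.
exact: leq_bigmax_cond.
Qed.

Lemma gale_nonface (N : {set 'I_m}) : nonface B g d N -> N \notin K.
Proof.
move=> nN; apply/gale_complexP => -[u fu uN]; have [i iN ui] := nN u fu.
by move: iN; rewrite -uN (gt_eqF (lt_trans (gale_gt0 G) ui)).
Qed.

(** * The polar polytope *)

Section Polytope.
Hypothesis m1 : (1 < m)%N.
Variable u0 : 'I_m -> R.
Hypothesis fu0 : feasible B g u0.
Hypothesis u0_gt0 : forall i, 0 < u0 i.

(** Polarity with respect to the interior point [u0]: for the relation [c] given by [e], the
    condition [u0 i + c i >= 0] says that [e] is at most 1 at this point. *)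
Definition gale_point (i : 'I_m) : 'rV[R]_n := - (u0 i)^-1 *: x i.
Let P := conv_hull gale_point.

Definition gale_hull (s : {set 'I_m}) : set 'rV[R]_n := [set y |
  exists2 a, convex_weights R 'I_m a /\ (forall i, i \notin s -> a i = 0) &
    \sum_i a i *: gale_point i = y]%classic.

Lemma dot_sum (e : 'rV[R]_n) (a : 'I_m -> R) :
  \sum_j e 0 j * (\sum_i a i *: gale_point i) 0 j =
  - \sum_i a i * ((\sum_j e 0 j * x i 0 j) / u0 i).
Proof.
under eq_bigr => j _ do rewrite summxE mulr_sumr.
rewrite exchange_big -sumrN; apply: eq_bigr => i _.
rewrite mulr_suml mulr_sumr -sumrN; apply: eq_bigr => j _; rewrite !mxE.
by ring.
Qed.

Lemma gale_point_in i : P (gale_point i).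
Proof.
exists [ffun k => (k == i)%:R].
  split=> [k|]; first by rewrite ffunE ler0n.
  rewrite (bigD1 i) //= ffunE eqxx big1 ?addr0 // => k /negbTE ki.
  by rewrite ffunE ki.
rewrite (bigD1 i) //= ffunE eqxx scale1r big1 ?addr0 // => k /negbTE ki.
by rewrite ffunE ki scale0r.
Qed.

Lemma dot_point (e : 'rV[R]_n) i :
  \sum_j e 0 j * gale_point i 0 j = - ((\sum_j e 0 j * x i 0 j) / u0 i).
Proof.
rewrite mulr_suml -sumrN; apply: eq_bigr => j _; rewrite !mxE; ring.
Qed.

(* A functional [e] with value at most [b > 0] on the polytope corresponds to
   the point [u0 + c / b] of the simple polytope, [c] being the relation given
   by [e]. *)
Lemma gale_polytope_face F : proper_face P F ->
  exists s, [/\ s \in K, F = gale_hull s & forall i, i \in s <-> F (gale_point i)].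
Proof.
move=> [[e [b [eb FE]]] FP]; pose c i := \sum_j e 0 j * x i 0 j.
have cr : relation B c by apply/relationP; exists e.
have cb i : 0 <= c i + b * u0 i.
  have := eb _ (gale_point_in i); rewrite dot_point -/(c i) lerNl ler_pdivlMr //.
  by rewrite mulNr -subr_ge0 opprK.
have wP a : convex_weights R 'I_m a -> P (\sum_i a i *: gale_point i).
  by move=> aw; exists a.
(* Otherwise the relation given by [e] is nonnegative, hence zero, and the face is all of [P]. *)
have b0 : 0 < b.
  rewrite ltNge; apply/negP => b0; have c0 i : 0 <= c i.
    have := cb i; have : b * u0 i <= 0 by rewrite mulr_le0_ge0 // ltW.
    by lra.
  have {}c0 := relation_ge0 G cr c0.
  have {}b0 : b = 0.
    apply/eqP; rewrite eq_le b0 /=; have := cb (Ordinal m0).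
    by rewrite c0 add0r pmulr_lge0.
  apply: FP; rewrite FE; apply/seteqP; split=> [y []//|y Py]; split=> //.
  have [a _ <-] := Py; rewrite /= dot_sum big1 ?oppr0 // => i _.
  by rewrite -/(c i) c0 mul0r mulr0.
pose u i := u0 i + b^-1 * c i.
have uE i : b * u i = c i + b * u0 i by rewrite /u mulrDr mulrA divff ?gt_eqF // mul1r addrC.
have fu : feasible B g u.
  by apply: feasible_relation => // i; rewrite -(pmulr_rge0 _ b0) uE.
have ptE i : \sum_j e 0 j * gale_point i 0 j = b - b * (u i / u0 i).
  rewrite dot_point -/(c i) mulrA uE mulrDl -mulrA divff ?gt_eqF // mulr1.
  by rewrite opprD addrC subrK.
exists [set i | u i == 0]; split.
- by apply/gale_complexP; exists u => // i; rewrite inE.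
- have dotE (a : {ffun 'I_m -> R}) : convex_weights R 'I_m a ->
      \sum_j e 0 j * (\sum_i a i *: gale_point i) 0 j =
      b - b * \sum_i a i * (u i / u0 i).
    move=> [_ a1]; rewrite dot_sum mulr_sumr -[X in X - _](mulr1 b) -a1 mulr_sumr.
    rewrite -sumrB -sumrN; apply: eq_bigr => i _.
    have := ptE i; rewrite dot_point -/(c i) => H.
    by rewrite -mulrN H; ring.
  rewrite FE; apply/seteqP; split=> [y [[a aw <-]]|y [a [aw as0] <-]].
    rewrite /= dotE // => E; exists a => //; split=> // i; rewrite inE => ui.
    have S : \sum_i a i * (u i / u0 i) = 0.
      have : b * \sum_i a i * (u i / u0 i) = 0 by lra.
      by move/eqP; rewrite mulf_eq0 (gt_eqF b0) => /eqP.
    have H k : 0 <= a k * (u k / u0 k).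
      by rewrite mulr_ge0 ?divr_ge0 ?(ltW (u0_gt0 _)) //; [case: aw|case: fu].
    have /eqP := sumr_ge0_eq0 H S i.
    by rewrite !mulf_eq0 invr_eq0 (gt_eqF (u0_gt0 i)) (negbTE ui) !orbF => /eqP.
  split; first exact: wP; rewrite /= dotE // big1 ?mulr0 ?subr0 // => i _.
  have [ui|ui] := eqVneq (u i) 0; first by rewrite ui mul0r mulr0.
  by rewrite as0 ?inE // mul0r.
- move=> i; rewrite inE FE /= ptE; split=> [/eqP ui|[_]].
    by split; [exact: gale_point_in|rewrite ui mul0r mulr0 subr0].
  move=> E; have : b * (u i / u0 i) = 0 by lra.
  by move/eqP; rewrite !mulf_eq0 invr_eq0 (gt_eqF b0) (gt_eqF (u0_gt0 i)) orbF.
Qed.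

(** The relation [u - u0] gives a functional with value [1 - u i / u0 i] at [gale_point i]; the
    maximum 1 is attained exactly where [u] vanishes. *)
Lemma gale_face_polytope s : s \in K -> exists2 F, proper_face P F &
  forall i, i \in s <-> F (gale_point i).
Proof.
move=> /gale_complexP[u fu us].
have /relationP[e eE] := relation_feasible fu fu0.
have ptE i : \sum_j e 0 j * gale_point i 0 j = 1 - u i / u0 i.
  rewrite dot_point -eE mulrBl divff ?gt_eqF //; ring.
have H i : i \in s <-> \sum_j e 0 j * gale_point i 0 j = 1.
  rewrite ptE -us; split=> [/eqP ->|E]; first by rewrite mul0r subr0.
  have : u i / u0 i = 0 by lra.
  by move/eqP; rewrite mulf_eq0 invr_eq0 (gt_eqF (u0_gt0 i)) orbF.
exists (P `&` [set y | \sum_j e 0 j * y 0 j = 1])%classic.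
  split.
    exists e, 1; split=> // y [a [a0 a1] <-].
    rewrite dot_sum -a1 -sumrN; apply: ler_sum => i _.
    rewrite -mulrN -[leRHS]mulr1 ler_wpM2l //.
    have := ptE i; rewrite dot_point => ->; rewrite gerBl divr_ge0 ?(ltW (u0_gt0 _)) //.
    by case: fu.
  move=> E; have all1 i : i \in s.
    by apply/H; have := gale_point_in i; rewrite -E => -[].
  have u00 i : u i = 0 by apply/eqP; rewrite us.
  have := @relation_ge0 _ _ _ _ _ _ _ G u0 _ (fun i => ltW (u0_gt0 i)) (Ordinal m0).
  case: fu fu0 => _ ug [_ u0g]; rewrite /relation u0g -ug big1 => [/(_ erefl)|i _].
    by apply/eqP; rewrite gt_eqF.
  by rewrite u00 scale0r.
move=> i; rewrite H; split=> [E|[]//]; split=> //; exact: gale_point_in.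
Qed.

Lemma gale_hull_simplex s : s \in K -> geometric_simplex (gale_hull s).
Proof.
move=> sK; exists #|s|, (fun k => gale_point (enum_val k)); split.
  move=> a _ a0 k.
  pose c i := (\sum_k a k * (enum_val k == i)%:R) * - (u0 i)^-1.
  have cE k' : c (enum_val k') = a k' * - (u0 (enum_val k'))^-1.
    rewrite /c (bigD1 k') //= eqxx mulr1 big1 ?addr0 // => j jk.
    by rewrite (inj_eq enum_val_inj) (negbTE jk) mulr0.
  have := fan_free gale_fan (c := c) sK; rewrite big_enum_val.
  under eq_bigr => k' _ do rewrite cE -scalerA.
  move=> /(_ a0)/(_ _ (enum_valP k)); rewrite cE => /eqP.
  by rewrite mulf_eq0 oppr_eq0 invr_eq0 (gt_eqF (u0_gt0 _)) orbF => /eqP.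
apply/seteqP; split=> y [a].
  move=> [[a0 a1] as0] <-; exists [ffun k => a (enum_val k)].
    split=> [k|]; first by rewrite ffunE.
    rewrite -a1 (bigID (mem s)) /= [X in _ = _ + X]big1 ?addr0 => [|i /as0//].
    by rewrite [RHS]big_enum_val; apply: eq_bigr => k _; rewrite ffunE.
  rewrite [RHS](bigID (mem s)) /= [X in _ = _ + X]big1 ?addr0 => [|i /as0 ->].
    by rewrite [RHS]big_enum_val; apply: eq_bigr => k _; rewrite ffunE.
  by rewrite scale0r.
move=> [a0 a1] <-.
pose b : {ffun 'I_m -> R} := [ffun i => \sum_k a k * (enum_val k == i)%:R].
have bE k : b (enum_val k) = a k.
  rewrite ffunE (bigD1 k) //= eqxx mulr1 big1 ?addr0 // => j jk.
  by rewrite (inj_eq enum_val_inj) (negbTE jk) mulr0.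
have b0 i : i \notin s -> b i = 0.
  move=> si; rewrite ffunE big1 // => k _; case: eqVneq => [e|]; rewrite ?mulr0 //.
  by move: si; rewrite -e enum_valP.
exists b.
  split=> //; split=> [i|].
    by rewrite ffunE sumr_ge0 // => k _; rewrite mulr_ge0.
  rewrite -a1 (bigID (mem s)) /= [X in _ + X]big1 ?addr0 => [|i /b0//].
  by rewrite big_enum_val; apply: eq_bigr => k _; rewrite bE.
rewrite (bigID (mem s)) /= [X in _ + X]big1 ?addr0 => [|i /b0 ->]; last by rewrite scale0r.
by rewrite big_enum_val; apply: eq_bigr => k _; rewrite bE.
Qed.

Lemma gale_hull1 i : gale_hull [set i] = [set gale_point i]%classic.
Proof.
have E a : (forall j, j \notin [set i] -> a j = 0) ->
    \sum_j a j *: gale_point j = a i *: gale_point i.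
  move=> a0; rewrite (bigD1 i) //= big1 ?addr0 // => j ji.
  by rewrite a0 ?scale0r // inE.
apply/seteqP; split=> y.
  move=> [a [[_ a1] a0] <-] /=; rewrite E // (_ : a i = 1) ?scale1r //.
  by rewrite -a1 (bigD1 i) //= big1 ?addr0 // => j ji; rewrite a0 // inE.
move=> /= ->; exists [ffun j => (j == i)%:R].
  split; last by move=> j; rewrite inE ffunE => /negbTE ->.
  split=> [j|]; first by rewrite ffunE ler0n.
  rewrite (bigD1 i) //= ffunE eqxx big1 ?addr0 // => j /negbTE ji.
  by rewrite ffunE ji.
rewrite E ?ffunE ?eqxx ?scale1r // => j; rewrite inE => /negbTE ji.
by rewrite ffunE ji.
Qed.

Lemma gale_polytopal_aux : polytopal R K.
Proof.
split; first exact: gale_complex_simplicial.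
have inj : injective gale_point.
  move=> i j ij; have [F _ Fi] := gale_face_polytope (gale_complex1 i).
  suff : j \in [set i] by rewrite inE => /eqP.
  by apply/Fi; rewrite -ij; apply/Fi; rewrite inE.
exists n, P, gale_point; split.
- split; first by exists m, gale_point.
  by move=> F /gale_polytope_face[s [sK -> _]]; exact: gale_hull_simplex.
- split=> [i _|i j _ _ /inj//|y yF].
    have [F pF Fi] := gale_face_polytope (gale_complex1 i).
    have [s [sK FE Fs]] := gale_polytope_face pF.
    have si : s = [set i] by apply/setP => j; apply/idP/idP => [/Fs/Fi|/Fi/Fs].
    by rewrite /polytope_vertices /= -gale_hull1 -si -FE; case: pF.
  (* A vertex that is all of [P] is not a proper face; two distinct points exclude this case. *)
  have [e|yP] := pselect ([set y]%classic = P).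
    have pt i : gale_point i = y by have := gale_point_in i; rewrite -e.
    have := inj (Ordinal m0) (Ordinal m1); rewrite !pt => /(_ erefl) [].
    by [].
  have [s [sK e _]] := gale_polytope_face (conj yF yP).
  have : gale_hull s y by rewrite -e.
  move=> [a [[_ a1] a0] ay].
  have [s0|/set0Pn[i si]] := eqVneq s finset.set0.
    move: a1; rewrite big1 => [/esym/eqP|i _]; first by rewrite oner_eq0.
    by rewrite a0 // s0 inE.
  exists i => //; have [F pF Fi] := gale_face_polytope sK.
  have : gale_hull s (gale_point i).
    have [s' [_ FE Fs']] := gale_polytope_face pF.
    have -> : s = s' by apply/setP => j; apply/idP/idP => [/Fi/Fs'|/Fs'/Fi].
    by rewrite -FE; apply/Fi.
  by rewrite -e.
- move=> s; split=> [/gale_face_polytope//|[F /gale_polytope_face[t [tK _ Ft]] Fs]].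
  by have -> : s = t by apply/setP => j; apply/idP/idP => [/Fs/Ft|/Ft/Fs].
Qed.

End Polytope.

Lemma gale_polytopal : (1 < m)%N -> polytopal R K.
Proof.
move=> m1; have [u fu u0] := face0; apply: (gale_polytopal_aux m1 fu) => i.
by rewrite lt_def u0 inE /=; case: fu.
Qed.

(** For a wedge, take [i] and [j] to be the vertices sent to [v] and to the new vertex. [wedgeP] is
    their interchangeability and refutes [distinguished] in both orders; [edge] refutes the third
    alternative. *)
Lemma gale_seed : (forall i j, i != j ->
    [\/ distinguished B g d i j, distinguished B g d j i |
        nonface B g d [set i; j]]) -> seed R K.
Proof.
move=> sep; split; first exact: gale_pl_sphere.
move=> [W [L [v [[[L0 Ld L1 _] _] [f [f' fK f'K] fL]]]]].
have f_inj := can_inj fK.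
have [fi fj] := (f'K (Some v), f'K None).
set i := f' (Some v) in fi; set j := f' None in fj.
have ij : i != j by apply: contra_eq_neq fi => ->; rewrite fj.
pose I2 : {set option W} := [set Some v; None]%SET.
have wedgeP (s : {set option W}) o : Some v \notin s -> None \notin s ->
    s \in wedge L v -> o \in I2 -> o |: s \in wedge L v.
  move=> vs Ns; rewrite inE => H oI.
  have {H} : exists2 b, b \in deletion L v & s = (Some @: b)%SET.
    have sub (a c : {set option W}) : a \subset I2 -> s = a :|: c -> s = c.
      move=> /fintype.subsetP aI sE; rewrite sE (_ : a = finset.set0) ?finset.set0U //.
      apply/setP => w; rewrite [RHS]inE; apply/negP => wa.
      have ws : w \in s by rewrite sE inE wa.
      have := aI _ wa; rewrite !inE => /orP[] /eqP we.
        by rewrite -we ws in vs.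
      by rewrite -we ws in Ns.
    case/orP: H => /imset2P[a b aI /imsetP[b' b'L ->] sE].
      exists b'; last by apply: sub sE; rewrite inE in aI.
      by move: b'L; rewrite !inE => /andP[-> /andP[-> _]].
    exists b' => //; apply: sub sE; rewrite inE in aI; exact: proper_sub.
  move=> [b bL ->]; rewrite inE; apply/orP; right; apply/imset2P.
  exists [set o] (Some @: b)%SET => //; last exact: imset_f.
  rewrite inE; apply/fintype.properP; split.
    by apply/fintype.subsetP => w; rewrite inE => /eqP ->.
  move: oI; rewrite !inE => /orP[] /eqP ->.
    by exists None; rewrite !inE.
  by exists (Some v); rewrite !inE ?eqxx ?orbT.
have edge : I2 \in wedge L v.
  rewrite inE; apply/orP; left; apply/imset2P.
  exists I2 finset.set0; rewrite ?finset.setU0 //; first by rewrite inE fintype.subxx.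
  apply/imsetP; exists finset.set0; last by rewrite imset0.
  by rewrite !inE L0 finset.setU0 L1.
have no k l o : k != l -> f k = o -> [set o; f l] = I2 -> o \in I2 ->
    ~ distinguished B g d k l.
  move=> kl fk oI oI2 [N [kN lN /gale_nonface nN /gale_complexP fN]].
  have im : (f @: N)%SET = o |: (f @: (N :\ k))%SET.
    by rewrite -{1}(finset.setD1K kN) imsetU1 fk.
  have H w : w \in I2 -> w \notin (f @: (N :\ k))%SET.
    rewrite -oI !inE -fk => /orP[] /eqP ->; rewrite mem_imset // !inE ?eqxx //.
    by rewrite (negbTE lN) andbF.
  move: nN; rewrite -fL im => /negP; apply; apply: wedgeP => //.
  - by apply: H; rewrite !inE eqxx.
  - by apply: H; rewrite !inE eqxx.
  - by rewrite fL.
case: (sep i j ij).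
- by apply: (no i j (Some v)); rewrite ?fj // !inE eqxx.
- by apply: (no j i None); rewrite ?fi // 1?eq_sym // ?inE ?eqxx // finset.setUC.
- move=> /gale_nonface; rewrite -fL imsetU1 imset_set1 fi fj; by rewrite edge.
Qed.

End GaleFan.

(** * Buchstaber number *)

Section Torus.
Variable R : realType.
Local Notation C := (cplx R).

Lemma torus_neq0 m (t : 'rV[C]_m) i : torus R m t -> t 0 i != 0.
Proof. by move=> /(_ i) ti; rewrite -normr_eq0 ti oner_eq0. Qed.

Lemma torus1 m : torus R m (const_mx 1).
Proof. by move=> i; rewrite mxE normr1. Qed.

(* A free subtorus meets the isotropy group of the point vanishing exactly on
   [s] trivially, so the 2-torsion of the former injects into the signs on the
   complement of [s]. *)
Lemma free_subtorus_le m r (K : {set {set 'I_m}}) (s : {set 'I_m}) :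
  s \in K -> has_free_subtorus R K r -> (r <= m - #|s|)%N.
Proof.
move=> sK [H [[Htorus [phi [_ phiM [phiH phi_inj _]]]] Hfree]].
have phi_torus t : torus R r t -> torus R m (phi t) by move=> /phiH/Htorus.
have phi1 : phi (const_mx 1) = const_mx 1.
  have E := phiM _ _ (@torus1 r) (@torus1 r).
  have e1 : coord_mul (const_mx 1) (const_mx 1) = const_mx 1 :> 'rV[C]_r.
    by apply/rowP => i; rewrite !mxE mulr1.
  apply/rowP => i; move/rowP/(_ i): E; rewrite e1 !mxE => E.
  by apply: (mulfI (torus_neq0 i (phi_torus _ (@torus1 r)))); rewrite mulr1 -E.
pose sg (e : {ffun 'I_r -> bool}) : 'rV[C]_r := \row_k (-1) ^+ e k.
have sg_torus e : torus R r (sg e) by move=> k; rewrite mxE normr_sign.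
have sgM e e' : coord_mul (sg e) (sg e') = sg [ffun k => e k (+) e' k].
  by apply/rowP => k; rewrite !mxE ffunE signr_addb.
have sq e i : phi (sg e) 0 i = 1 \/ phi (sg e) 0 i = -1.
  have : coord_mul (phi (sg e)) (phi (sg e)) = const_mx 1.
    rewrite -phiM // -phi1 sgM; congr phi; apply/rowP => k.
    by rewrite !mxE ffunE addbb.
  move/rowP/(_ i); rewrite !mxE -expr2 => /eqP.
  by rewrite sqrf_eq1 => /orP[] /eqP ->; [left|right].
have N1 : -1 != 1 :> C by rewrite eq_sym -addr_eq0 (pnatr_eq0 _ 2).
pose neg e := [set i | (i \notin s) && (phi (sg e) 0 i == -1)].
have neg_inj : injective neg.
  move=> e e' ee'; pose f : {ffun 'I_r -> bool} := [ffun k => e k (+) e' k].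
  have f1 i : i \notin s -> phi (sg f) 0 i = 1.
    move=> si; rewrite -sgM phiM // mxE.
    move/setP/(_ i): ee'; rewrite !inE si /=.
    case: (sq e i) => ->; case: (sq e' i) => ->;
      rewrite ?eqxx ?[1 == -1]eq_sym ?(negbTE N1) // ?mulr1 // => _.
    by rewrite mulrNN mulr1.
  have fE : phi (sg f) = const_mx 1.
    pose x : 'rV[C]_m := \row_i (i \notin s)%:R.
    apply: (Hfree _ x); first exact: phiH.
      exists s => // i; rewrite mxE; case: (i \in s) => /=.
        by rewrite normr0 ler01.
      by rewrite normr1.
    apply/rowP => i; rewrite !mxE; case: (boolP (i \in s)) => si; first by rewrite mulr0.
    by rewrite f1 ?mul1r.
  have /rowP f0 : sg f = const_mx 1.
    apply: phi_inj; rewrite ?inE //; first exact: torus1.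
    by rewrite fE phi1.
  apply/ffunP => k; have := f0 k; rewrite !mxE ffunE.
  by case: (e k); case: (e' k) => //= /eqP; rewrite expr1 (negbTE N1).
have : (neg @: [set: {ffun 'I_r -> bool}])%SET \subset powerset (~: s).
  apply/fintype.subsetP => _ /imsetP[e _ ->]; rewrite inE.
  by apply/fintype.subsetP => i; rewrite !inE => /andP[].
move=> /subset_leq_card; rewrite card_imset // card_powerset cardsT card_ffun.
by rewrite card_bool card_ord leq_exp2l // cardsCs finset.setCK card_ord.
Qed.

(** * The torus given by integral vectors *)

Section Characters.
Variables (m p : nat) (A : 'I_m -> 'rV[int]_p).
Hypothesis A0 : forall i k, 0 <= A i 0 k.

(** With nonnegative exponents this monomial map is polynomial, hence continuous on the whole space
    and not only on the torus. *)
Definition character (t : 'rV[C]_p) : 'rV[C]_m :=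
  \row_i \prod_k t 0 k ^+ `|A i 0%R k|%N.

Lemma character_continuous : continuous character.
Proof.
have -> : character = fun t => \sum_i (\prod_k t 0 k ^+ `|A i 0%R k|%N) *: delta_mx 0 i.
  apply/funext => t; rewrite [LHS]row_sum_delta; apply: eq_bigr => i _.
  by rewrite mxE.
apply: continuous_big => [|i _]; first exact: add_continuous.
move=> t; apply: continuousZr_tmp.
move: t; apply: continuous_big => [|k _]; first exact: mul_continuous.
have cX n : continuous (fun t : 'rV[C]_p => t 0 k ^+ n).
  elim: n => [|n IH] t.
    rewrite (_ : (fun _ => _) = fun=> 1); first exact: cst_continuous.
    by apply/funext => v; rewrite expr0.
  rewrite (_ : (fun _ => _) = (fun v : 'rV[C]_p => v 0 k) \* (fun v => v 0 k ^+ n)).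
    by apply: continuousM; [exact: coord_continuous|exact: IH].
  by apply/funext => v; rewrite exprS.
exact: cX.
Qed.

Lemma character_torus t : torus R p t -> torus R m (character t).
Proof.
move=> tT i; rewrite mxE normr_prod big1 // => k _.
by rewrite normrX tT expr1n.
Qed.

Lemma characterM t t' :
  character (coord_mul t t') = coord_mul (character t) (character t').
Proof.
apply/rowP => i; rewrite !mxE -big_split; apply: eq_bigr => k _.
by rewrite mxE exprMn.
Qed.

(** With integer exponents, [chi] is a homomorphism from the lattice that is trivial on generators,
    hence everywhere; on unit vectors it gives the coordinates of [t]. *)
Lemma character_eq1 (T : {set 'I_m}) (t : 'rV[C]_p) : spans A T -> (forall k, t 0 k != 0) ->
  (forall i, i \in T -> character t 0 i = 1) -> t = const_mx 1.
Proof.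
move=> AT t0 tT; pose chi (v : 'rV[int]_p) := \prod_k t 0 k ^ v 0 k.
have chiD u v : chi (u + v) = chi u * chi v.
  rewrite -big_split; apply: eq_bigr => k _; rewrite mxE expfzDr //.
have chi0 : chi 0 = 1 by rewrite /chi big1 // => k _; rewrite mxE.
have chiZ c v : chi v = 1 -> chi (c *: v) = 1.
  move=> v1; suff -> : chi (c *: v) = chi v ^ c by rewrite v1 exp1rz.
  rewrite /chi (big_morph (fun x => x ^ c) (fun x y => expfzMl x y c) (exp1rz _ c)).
  by apply: eq_bigr => k _; rewrite mxE mulrC exprz_exp.
have chiA i : chi (A i) = character t 0 i.
  by rewrite mxE; apply: eq_bigr => k _; rewrite [RHS]exprnP gez0_abs.
have chi1 v : chi v = 1.
  have [c ->] := AT v; elim/big_rec: _ => [//|i u iT u1].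
  by rewrite chiD u1 mulr1 chiZ // chiA tT.
apply/rowP => k; rewrite mxE -(chi1 (delta_mx 0 k)) /chi (bigD1 k) //= mxE !eqxx.
rewrite expr1z big1 ?mulr1 // => j jk; by rewrite mxE (negbTE jk) andbF.
Qed.

End Characters.
End Torus.

(** A fixed point has nonzero coordinates off some face [s], so the characters are 1 there. This
    complement supports a feasible point, so its vectors generate the lattice. The upper bound comes
    from a facet, which has [m - p] vertices. *)
Lemma gale_buchstaber (R : realType) (m p : nat) (B : 'I_m -> 'rV[R]_p) g A d :
  gale B g A d -> (0 < m)%N -> (p <= m)%N -> buchstaber_number R (gale_complex B g) p.
Proof.
move=> G m0 pm; have A0 := gale_ge0 G; split; last first.
  have [s [sK _] sE] := gale_facet G m0 => r /(free_subtorus_le sK).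
  by rewrite sE subKn.
exists (character A @` torus R p)%classic; split.
  split; first by move=> _ [t tT <-]; exact: character_torus.
  exists (character A); split.
  - by apply: continuous_subspaceT; exact: character_continuous.
  - by move=> s t _ _; exact: characterM.
  split=> [t tT|t t'|_ [t tT <-]]; [by exists t| |by exists t].
  rewrite !inE => tT t'T tt'; have [u fu _] := face0 G m0.
  pose q : 'rV[cplx R]_p := \row_k (t 0 k / t' 0 k).
  have tE : t = coord_mul q t'.
    by apply/rowP => k; rewrite !mxE divfK // torus_neq0.
  suff q1 : q = const_mx 1 by rewrite tE q1; apply/rowP => k; rewrite !mxE mul1r.
  apply: (character_eq1 A0 (spanA_supp G fu)) => [k|i _].
    by rewrite mxE mulf_neq0 ?invr_eq0 ?torus_neq0.
  apply: (mulIf (torus_neq0 i (character_torus A t'T))).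
  have := congr1 (fun v : 'rV_m => v 0 i) tt'; rewrite {1}tE characterM mxE => ->.
  by rewrite mul1r.
move=> _ x [t tT <-] [s /gale_complexP[u fu us] xs] /rowP tx.
suff -> : t = const_mx 1.
  by apply/rowP => i; rewrite !mxE big1 // => k _; rewrite mxE expr1n.
apply: (character_eq1 A0 (spanA_supp G fu)) => [k|i]; first exact: torus_neq0.
rewrite inE us => is_; have [_ /(_ is_) xi] := xs i.
have x0 : x 0 i != 0 by rewrite -normr_eq0 xi oner_eq0.
by apply: (mulIf x0); have := tx i; rewrite mxE => ->; rewrite mul1r.
Qed.

Theorem corollary3p2 (R : realType) (p m n : nat) (hp : (3 <= p)%N)
    (hm : (m <= 2 ^ p - 1)%N) (hn : (2 <= n)%N) (hpmn : p%:Z = m%:Z - n%:Z) :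
  exists K : {set {set 'I_m}},
    [/\ polytopal R K,
        complex_dim K = n%:Z - 1,
        seed R K &
        buchstaber_number R K p].
Proof.
have mE : m = (n + p)%N by lia.
have [|B [g [A [d [G sep]]]]] := @weak_seed_gale_exists R p m hp; first by lia.
exists (gale_complex B g); split.
- by apply: gale_polytopal G _ _; lia.
- have -> : n = (m - p)%N by lia.
  by apply: gale_complex_dim G _; lia.
- by apply: gale_seed G _ sep; lia.
- by apply: gale_buchstaber G _ _; lia.
Qed.
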